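(* Let $X\subseteq\mathbb{R}^n$ be nonempty, closed, convex and bounded, and let $F:X\to\mathbb{R}^n$ be monotone on $X$ (i.e. $\langle F(x)-F(y),x-y\rangle\ge 0$ for all $x,y\in X$) and satisfy, for some $\nu\in[0,\infty)$, $L_\nu>0$, $M_\nu\ge 0$, the growth condition $\|F(x)-F(y)\|_*\le L_\nu\|x-y\|^\nu+M_\nu$ for all $x,y\in X$. Let the samples satisfy the unbiasedness and bounded-variance conditions (with variance bound $\sigma^2$) stated in the context. Let $D>0$ satisfy $\max_{x,z\in X}B_\psi(z,x)\le D$ and set $$\widehat D=\begin{cases}\dfrac{2^{2+\nu}L_\nu^2D^\nu}{\alpha^{1+\nu}}+\dfrac{17\sigma^2+16M_\nu^2}{2\alpha}&\text{if }\nu>0,\\[2mm]\dfrac{9\sigma^2+2(L_0+M_0)^2}{2\alpha}&\text{if }\nu=0.\end{cases}$$ Then, for the stochastic Popov mirror-prox algorithm with diminishing step size $\gamma_t=\frac{c}{(t+1)^a}$, where $c>0$ and $0<a<1$, we have for all $T\ge0$ $$\mathsf{E}\left[G\left(\frac{\sum_{t=0}^T\gamma_ty_{t+1}}{\sum_{t=0}^T\gamma_t}\right)\right]\le\begin{cases}\dfrac{2D}{c(T+1)^{1-a}}+\dfrac{\widehat Dc}{(1-2a)(T+1)^a}&\text{when }0<a<\frac12,\\[2mm]\dfrac{2D}{c(T+1)^{1-a}}+\dfrac{\widehat Dc(1+\ln(T+1))}{(T+1)^{1-a}}&\text{when }a=\frac12,\\[2mm]\dfrac{2D}{c(T+1)^{1-a}}+\dfrac{2a\widehat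 Dc}{(2a-1)(T+1)^{1-a}}&\text{when }\frac12<a<1.\end{cases}$$
   Context: $\|\cdot\|$ is an arbitrary norm on $\mathbb{R}^n$, $\langle\cdot,\cdot\rangle$ the standard inner product, and $\|x\|_*=\max_{\|z\|\le1}\langle x,z\rangle$ the conjugate norm. For $\nu=0$ the term $\|x-y\|^0$ is read as $1$, and $L_0,M_0$ denote $L_\nu,M_\nu$ at $\nu=0$. The function $\psi:X\to\mathbb{R}$ is continuously differentiable and $\alpha$-strongly convex for some $\alpha>0$: $\psi(z)\ge\psi(x)+\langle\nabla\psi(x),z-x\rangle+\frac{\alpha}{2}\|z-x\|^2$ for all $x,z\in X$. Its Bregman divergence is $B_\psi(z,x)=\psi(z)-\psi(x)-\langle\nabla\psi(x),z-x\rangle$, $x,z\in X$. $F(x)=\mathsf{E}[\widehat F(x,\xi)]$ for all $x\in X$, where $\xi$ is a random variable with values in a set $\Omega$. Stochastic Popov mirror-prox algorithm: $x_0\in X$ is random with $\mathsf{E}[\|x_0\|^2]<\infty$, $y_0=x_0$, and for $t\ge0$ with step size $\gamma_t>0$, $$y_{t+1}=\operatorname*{argmin}_{z\in X}\left[\langle\gamma_t\widehat F(y_t,\xi_t)-\nabla\psi(x_t),z\rangle+\psi(z)\right],$$ $$x_{t+1}=\operatorname*{argmin}_{z\in X}\left[\langle\gamma_t\widehat F(y_{t+1},\xi_{t+1})-\nabla\psi(x_t),z\rangle+\psi(z)\right],$$ where $\xi_t\in\Omega$ is the random sample drawn at the iterate $y_t$. Information: $\mathcal{F}_{-1}=\{x_0\}$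 and $\mathcal{F}_t=\{x_0\}\cup\{\xi_\tau\}_{\tau=0}^t$ for $t\ge0$ (conditioning is on the generated $\sigma$-algebras). Sampling conditions: for all $z\in X$ and $t\ge0$, $\mathsf{E}[\widehat F(z,\xi_t)\mid\mathcal{F}_{t-1}]=F(z)$ and $\mathsf{E}[\|\widehat F(z,\xi_t)-F(z)\|_*^2\mid\mathcal{F}_{t-1}]\le\sigma^2$; these are understood to apply also at the $\mathcal{F}_{t-1}$-measurable point $z=y_t$ at which $\xi_t$ is drawn. Dual gap function: $G(x)=\sup_{z\in X}\langle F(z),x-z\rangle$ for $x\in X$. *)

(* Defs.v *)
From HB Require Import structures.
From mathcomp Require Import all_boot all_order all_algebra.
From mathcomp Require Import all_classical all_reals all_analysis.
From mathcomp Require Import measurable_realfun.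

Set Implicit Arguments.
Unset Strict Implicit.
Unset Printing Implicit Defensive.

Import Order.TTheory GRing.Theory Num.Theory.
Import numFieldNormedType.Exports.

Local Open Scope classical_set_scope.
Local Open Scope ring_scope.

Section euclidean.
Context {R : realType} {n : nat}.
Implicit Types (X : set 'rV[R]_n) (x z : 'rV[R]_n) (nrm psi : 'rV[R]_n -> R).
Implicit Types (F gpsi : 'rV[R]_n -> 'rV[R]_n).

Definition dot x z : R := \sum_(i < n) x 0 i * z 0 i.

(* An arbitrary norm on R^n.  The norm [`| x |] carried by the library type
   ['rV[R]_n] is the sup norm; it is used below only for notions that do not
   depend on the norm (topology, boundedness, differentiability). *)
Record is_norm nrm : Prop := IsNorm {
  is_norm_triangle : forall x z, nrm (x + z) <= nrm x + nrm z;
  is_norm_homog : forall (k : R) x, nrm (k *: x) = `|k| * nrm x;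
  is_norm_eq0 : forall x, nrm x = 0 -> x = 0 }.

Definition dual_norm nrm x : R := sup [set dot x z | z in [set z | nrm z <= 1]].

Definition monotone_on X F : Prop :=
  forall x z, X x -> X z -> 0 <= dot (F x - F z) (x - z).

(* Since [0 `^ 0 = 1], the convention [||x - z||^0 = 1] at nu = 0 is built in. *)
Definition growth_condition nrm X F (nu L M : R) : Prop :=
  forall x z, X x -> X z ->
    dual_norm nrm (F x - F z) <= L * nrm (x - z) `^ nu + M.

(* Continuous differentiability on X, relative to X (whose interior may be
   empty), with [gpsi] as the gradient map.  The values of [psi] and [gpsi]
   outside X are irrelevant. *)
Definition C1_on X psi gpsi : Prop :=
  (forall x, X x -> forall e : R, 0 < e ->
     \forall z \near within X (nbhs x),
       `|psi z - psi x - dot (gpsi x) (z - x)| <= e * `|z - x|) /\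
  {within X, continuous gpsi}.

Definition strongly_convex_on nrm X psi gpsi (alpha : R) : Prop :=
  forall x z, X x -> X z ->
    psi x + dot (gpsi x) (z - x) + alpha / 2 * nrm (z - x) ^+ 2 <= psi z.

Definition bregman psi gpsi z x : R := psi z - psi x - dot (gpsi x) (z - x).

Definition is_argmin X (f : 'rV[R]_n -> R) z : Prop :=
  X z /\ forall u, X u -> f z <= f u.

Definition prox_objective psi gpsi (g x z : 'rV[R]_n) : R :=
  dot (g - gpsi x) z + psi z.

Definition dual_gap X F x : \bar R :=
  ereal_sup [set (dot (F z) (x - z))%:E | z in X].

End euclidean.

Notation borel_rV R n := (g_sigma_algebraType (@open 'rV[R]_n)).

Section conditional_expectation.
Context {d} {S : measurableType d} {R : realType} (P : probability S R).

(* [h] is a version of the conditional expectation of [f] given the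
   sigma-algebra <<s G>>; [f] is integrable, or measurable and nonnegative. *)
Definition is_cond_exp (G : set (set S)) (f h : S -> \bar R) : Prop :=
  [/\ P.-integrable setT f \/
        (measurable_fun setT f /\ forall w, (0 <= f w)%E),
      preimage_set_system setT h measurable `<=` <<s G >> &
      forall A, <<s G >> A ->
        (\int[P]_(w in A) h w = \int[P]_(w in A) f w)%E].

End conditional_expectation.

Section stochastic_oracle.
Context {d d'} {S : measurableType d} {Om : measurableType d'} {R : realType}.
Context (P : probability S R) {n : nat}.
Implicit Types (nrm : 'rV[R]_n -> R) (X : set 'rV[R]_n).
Implicit Types (F : 'rV[R]_n -> 'rV[R]_n) (Fhat : 'rV[R]_n -> Om -> 'rV[R]_n).
Implicit Types (xi : S -> Om) (Z : S -> 'rV[R]_n) (xis : nat -> S -> Om).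

Definition oracle_measurable X Fhat : Prop :=
  measurable_fun (X `*` setT : set (borel_rV R n * Om)%type)
    (fun p => Fhat p.1 p.2 : borel_rV R n).

Definition oracle_mean X F Fhat xi : Prop :=
  forall x i, X x -> ('E_P[fun w => (Fhat x (xi w) 0 i)%R] = (F x 0 i)%:E)%E.

(* Generators of the sigma-algebra of F_{t-1}, i.e. of the information
   carried by x_0 and xi_tau for 0 <= tau < t; in particular [history x0 xis 0]
   corresponds to F_{-1}. *)
Definition history (x0 : S -> 'rV[R]_n) xis (t : nat) : set (set S) :=
  preimage_set_system setT (x0 : S -> borel_rV R n) measurable `|`
  \bigcup_(tau in `I_t) preimage_set_system setT (xis tau) measurable.

(* E[Fhat(Z, xi) | G] = F(Z) at a random point Z, coordinatewise. *)
Definition unbiased_at (G : set (set S)) F Fhat xi Z : Prop :=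
  forall i, is_cond_exp P G (fun w => (Fhat (Z w) (xi w) 0 i)%:E)
                            (fun w => (F (Z w) 0 i)%:E).

Definition bounded_variance_at nrm (G : set (set S)) F Fhat xi Z (sigma : R)
    : Prop :=
  exists2 h : S -> \bar R,
    is_cond_exp P G
      (fun w => (dual_norm nrm (Fhat (Z w) (xi w) - F (Z w)) ^+ 2)%:E) h &
    {ae P, forall w, (h w <= (sigma ^+ 2)%:E)%E}.

End stochastic_oracle.

Section popov.
Context {S Om : Type} {R : realType} {n : nat}.
Implicit Types (x y : nat -> S -> 'rV[R]_n).

Definition popov_mirror_prox (X : set 'rV[R]_n) (psi : 'rV[R]_n -> R)
    (gpsi : 'rV[R]_n -> 'rV[R]_n) (Fhat : 'rV[R]_n -> Om -> 'rV[R]_n)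
    (gamma : nat -> R) (xis : nat -> S -> Om) x y : Prop :=
  [/\ forall w, X (x 0%N w),
      forall w, y 0%N w = x 0%N w,
      forall t w, is_argmin X
        (prox_objective psi gpsi (gamma t *: Fhat (y t w) (xis t w)) (x t w))
        (y t.+1 w) &
      forall t w, is_argmin X
        (prox_objective psi gpsi
           (gamma t *: Fhat (y t.+1 w) (xis t.+1 w)) (x t w))
        (x t.+1 w)].

Definition weighted_average (gamma : nat -> R) y (T : nat) (w : S) : 'rV[R]_n :=
  (\sum_(0 <= t < T.+1) gamma t)^-1 *:
    \sum_(0 <= t < T.+1) gamma t *: y t.+1 w.

End popov.

Definition step_size {R : realType} (c a : R) (t : nat) : R :=
  c / (t.+1%:R `^ a).

Definition Dhat {R : realType} (nu L M alpha D sigma : R) : R :=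
  if 0 < nu then
    2 `^ (2 + nu) * L ^+ 2 * D `^ nu / alpha `^ (1 + nu)
    + (17 * sigma ^+ 2 + 16 * M ^+ 2) / (2 * alpha)
  else (9 * sigma ^+ 2 + 2 * (L + M) ^+ 2) / (2 * alpha).

(* Main.v *)
(* Write g_t for the sample at y_t and e_t = g_t - F(y_t) for its noise. The
   three-point identity for the two prox steps gives
     gamma_t <g_{t+1}, y_{t+1} - z> <= B(z, x_t) - B(z, x_{t+1})
                               + gamma_t^2 ||g_{t+1} - g_t||_*^2 / (2 alpha).
   The noise term <e_{t+1}, z> cannot be averaged directly, since z is chosen
   by the supremum in the gap after the noise is known. It is absorbed by a
   ghost mirror descent u_t driven by -e_{t+1}: this costs another D and
   gamma_t^2 ||e_{t+1}||_*^2 / (2 alpha), and leaves only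
   <e_{t+1}, y_{t+1} - u_t>, which has mean zero because y_{t+1} and u_t are
   known before xi_{t+1} is drawn. Boundedness of X turns the growth condition
   into the uniform bound ||F x - F z||_* <= A with
   A = L (2D/alpha)^(nu/2) + M, so that
     E[G] <= (2D + (2A^2 + 9 sigma^2)/(2 alpha) sum gamma_t^2) / sum gamma_t. *)

Require Import Defs.
From HB Require Import structures.
From mathcomp Require Import all_boot all_order all_algebra.
From mathcomp Require Import all_classical all_reals all_analysis.
From mathcomp Require Import measurable_realfun.
From mathcomp Require Import ring lra.

Set Implicit Arguments.
Unset Strict Implicit.
Unset Printing Implicit Defensive.

Import Order.TTheory GRing.Theory Num.Theory.
Import numFieldNormedType.Exports.
Local Open Scope classical_set_scope.
Local Open Scope ring_scope.

(** * Norms and their duals *)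

Section dot_product.
Context {R : realType} {n : nat}.
Implicit Types x y z : 'rV[R]_n.

Lemma dotC x y : dot x y = dot y x.
Proof. by apply: eq_bigr => i _; rewrite mulrC. Qed.

Lemma dotDr x y z : dot x (y + z) = dot x y + dot x z.
Proof. by rewrite -big_split; apply: eq_bigr => i _; rewrite !mxE mulrDr. Qed.

Lemma dotZr (k : R) x y : dot x (k *: y) = k * dot x y.
Proof. by rewrite /dot mulr_sumr; apply: eq_bigr => i _; rewrite !mxE mulrCA. Qed.

Lemma dotDl x y z : dot (x + y) z = dot x z + dot y z.
Proof. by rewrite dotC dotDr !(dotC z). Qed.

Lemma dotZl (k : R) x y : dot (k *: x) y = k * dot x y.
Proof. by rewrite dotC dotZr dotC. Qed.

Lemma dotNr x y : dot x (- y) = - dot x y.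
Proof. by rewrite -scaleN1r dotZr mulN1r. Qed.

Lemma dotNl x y : dot (- x) y = - dot x y.
Proof. by rewrite dotC dotNr dotC. Qed.

Lemma dot0r x : dot x 0 = 0.
Proof. by rewrite -(scale0r x) dotZr mul0r. Qed.

Lemma dot_sumr (I : Type) (r : seq I) x (f : I -> 'rV[R]_n) :
  dot x (\sum_(i <- r) f i) = \sum_(i <- r) dot x (f i).
Proof. by apply: (big_morph (dot x)); [exact: dotDr|exact: dot0r]. Qed.

Lemma ler_coord_norm x i : `|x 0 i| <= `|x|.
Proof.
rewrite [leRHS]mx_normrE.
exact: (le_bigmax _ (fun ij : 'I_1 * 'I_n => `|x ij.1 ij.2|) (0, i)).
Qed.

Lemma dist_le_continuous (V : pseudoMetricNormedZmodType R)
    (f : 'rV[R]_n -> V) (C : R) : 0 <= C ->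
  (forall x z, `|f x - f z| <= C * `|x - z|) -> continuous f.
Proof.
move=> C0 fC x; apply/(cvgrPdist_le (F := nbhs x) (FF := nbhs_filter x)) => e e0.
(* The radius uses [C + 1] because [C] may be zero. *)
apply: (filterS _ (nbhsx_ballx x (e / (C + 1)) _)); last first.
  by rewrite divr_gt0 ?ltr_wpDl.
move=> z /=; rewrite -ball_normE /= => /ltW; rewrite ler_pdivlMr ?ltr_wpDl// => xz.
by rewrite (le_trans (fC x z))// (le_trans _ xz)// mulrC ler_wpM2l// lerDl.
Qed.

Lemma normr_dot_le x z : `|dot x z| <= n%:R * `|x| * `|z|.
Proof.
apply: le_trans (ler_norm_sum _ _ _) _.
rewrite -mulrA -[in n%:R](card_ord n) mulr_natl -sumr_const.
by apply: ler_sum => i _; rewrite normrM ler_pM// ler_coord_norm.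
Qed.

End dot_product.

Section norm.
Context {R : realType} {n : nat} {nrm : 'rV[R]_n -> R} (nrmP : is_norm nrm).
Implicit Types (x y z : 'rV[R]_n) (X : set 'rV[R]_n).

Lemma is_norm0 : nrm 0 = 0.
Proof. by rewrite -(scale0r 0) (is_norm_homog nrmP) normr0 mul0r. Qed.

Lemma is_normN x : nrm (- x) = nrm x.
Proof. by rewrite -scaleN1r (is_norm_homog nrmP) normrN normr1 mul1r. Qed.

Lemma is_norm_ge0 x : 0 <= nrm x.
Proof.
have := is_norm_triangle nrmP x (- x).
by rewrite subrr is_norm0 is_normN -mulr2n pmulrn_lge0.
Qed.

(** Expand [x] in the standard basis; [C] is the sum of the norms of the basis vectors. *)
Lemma is_norm_le_norm : exists2 C, 0 <= C & forall x, nrm x <= C * `|x|.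
Proof.
exists (\sum_(i < n) nrm (delta_mx 0 i)).
  by apply: sumr_ge0 => i _; exact: is_norm_ge0.
move=> x; rewrite [in nrm x](row_sum_delta x) mulr_suml.
apply: (@le_trans _ _ (\sum_i nrm (x 0 i *: delta_mx 0 i))).
  elim/big_ind2 : _ => [|a b a' b' ab ab'|//]; first by rewrite is_norm0.
  by rewrite (le_trans (is_norm_triangle nrmP _ _))// lerD.
apply: ler_sum => i _; rewrite (is_norm_homog nrmP) mulrC.
by rewrite ler_wpM2l ?is_norm_ge0 ?ler_coord_norm.
Qed.

Lemma is_norm_continuous : continuous nrm.
Proof.
have [C C0 leC] := is_norm_le_norm.
have tri u v : nrm u - nrm v <= C * `|u - v|.
  rewrite lerBlDr (le_trans _ (lerD (leC _) (lexx _)))//.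
  by rewrite -{1}(subrK v u) (is_norm_triangle nrmP).
apply: (dist_le_continuous C0) => x z.
by rewrite ler_norml tri lerNl opprB (le_trans (tri z x))// distrC.
Qed.

(** Equivalence of norms: [nrm] is continuous, so it attains its minimum on the compact sup-norm
    unit sphere; that minimum is positive, and homogeneity carries the bound to every [x]. *)
Lemma norm_le_is_norm : exists2 k, 0 < k & forall x, `|x| <= k * nrm x.
Proof.
pose A := [set x : 'rV[R]_n | `|x| = 1].
(* The sphere is empty only when 0 is the sole vector, that is, when [n = 0]. *)
have [x0|/set0P/negP/negPn/eqP AE] := pselect (A !=set0); last first.
  exists 1 => // x; have [->|x0] := eqVneq x 0.
    by rewrite normr0 mul1r is_norm_ge0.
  suff : A (`|x|^-1 *: x) by rewrite AE.
  by rewrite /A/= normrZ normfV normr_id mulVf// normr_eq0.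
have cA : compact A.
  apply: bounded_closed_compact.
    exists 1; split; first exact: num_real.
    by move=> M M1 x /= ->; exact: ltW.
  apply: (@closed_comp _ _ (fun x : 'rV[R]_n => `|x|) [set 1]); last exact: closed_eq.
  by move=> x _; exact: norm_continuous.
have [u uA umin] := EVT_min_rV x0 cA (continuous_subspaceT is_norm_continuous).
have nu0 : 0 < nrm u.
  rewrite lt_neqAle is_norm_ge0 andbT eq_sym; apply/eqP => /(is_norm_eq0 nrmP) u0.
  by move: uA; rewrite u0 inE /A/= normr0 => /esym/eqP; rewrite oner_eq0.
exists (nrm u)^-1; first by rewrite invr_gt0.
move=> x; have [->|x0'] := eqVneq x 0.
  by rewrite normr0 mulr_ge0 ?is_norm_ge0 ?invr_ge0 ?is_norm_ge0.
have : nrm u <= nrm (`|x|^-1 *: x).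
  by apply: umin; rewrite inE /A/= normrZ normfV normr_id mulVf// normr_eq0.
rewrite (is_norm_homog nrmP) normfV normr_id ler_pdivlMl ?normr_gt0//.
by rewrite ler_pdivlMl// mulrC.
Qed.

(** Makes the [sup] in [dual_norm] a true least upper bound instead of the default value 0 that
    [sup] takes on unbounded sets. *)
Lemma has_sup_dual_norm x : has_sup [set dot x z | z in [set z | nrm z <= 1]].
Proof.
split; first by exists (dot x 0), 0 => //=; rewrite is_norm0.
have [k k0 lek] := norm_le_is_norm.
exists (n%:R * `|x| * k) => _ [z /= z1 <-].
rewrite (le_trans (ler_norm _))// (le_trans (normr_dot_le _ _))//.
by rewrite ler_wpM2l ?mulr_ge0// (le_trans (lek z))// ler_piMr// ltW.
Qed.

Lemma dual_norm_ge0 x : 0 <= dual_norm nrm x.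
Proof.
apply: (sup_upper_bound (has_sup_dual_norm x)).
by exists 0 => /=; rewrite ?is_norm0 ?dot0r.
Qed.

Lemma dot_le_dual_norm x z : dot x z <= dual_norm nrm x * nrm z.
Proof.
have [->|z0] := eqVneq z 0; first by rewrite dot0r is_norm0 mulr0.
have nz0 : 0 < nrm z.
  rewrite lt_neqAle is_norm_ge0 andbT eq_sym; apply/eqP => /(is_norm_eq0 nrmP).
  exact/eqP.
rewrite -ler_pdivrMr// mulrC -dotZr.
apply: (sup_upper_bound (has_sup_dual_norm x)); exists ((nrm z)^-1 *: z) => //=.
by rewrite (is_norm_homog nrmP) normfV ger0_norm ?is_norm_ge0// mulVf// gt_eqF.
Qed.

Lemma dual_norm_le x r :
  (forall z, nrm z <= 1 -> dot x z <= r) -> dual_norm nrm x <= r.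
Proof.
move=> H; apply: ge_sup; first by have [] := has_sup_dual_norm x.
by move=> _ [z /= z1 <-]; exact: H.
Qed.

Lemma dual_normD x y :
  dual_norm nrm (x + y) <= dual_norm nrm x + dual_norm nrm y.
Proof.
apply: dual_norm_le => z z1; rewrite dotDl lerD//.
- by rewrite (le_trans (dot_le_dual_norm _ _))// ler_piMr// dual_norm_ge0.
- by rewrite (le_trans (dot_le_dual_norm _ _))// ler_piMr// dual_norm_ge0.
Qed.

Lemma dual_normN x : dual_norm nrm (- x) = dual_norm nrm x.
Proof.
suff H y : dual_norm nrm (- y) <= dual_norm nrm y.
  by apply/eqP; rewrite eq_le H -{1}(opprK x) H.
apply: dual_norm_le => z z1; rewrite dotNl -dotNr.
rewrite (le_trans (dot_le_dual_norm _ _))// is_normN.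
by rewrite ler_piMr// dual_norm_ge0.
Qed.

(** A coordinate is the pairing with a basis vector, whose norm is at most [C]. This later turns
    dual-norm bounds on [F] into bounds on its coordinates. *)
Lemma coord_le_dual_norm :
  exists2 C, 0 <= C & forall x i, `|x 0 i| <= C * dual_norm nrm x.
Proof.
have [C C0 leC] := is_norm_le_norm.
exists C => // x i.
have dotd (v : 'rV[R]_n) : dot v (delta_mx 0 i) = v 0 i.
  rewrite /dot (bigD1 i)//= mxE !eqxx mulr1 big1 ?addr0// => j /negbTE ji.
  by rewrite mxE ji andbF mulr0.
have nd : nrm (delta_mx 0 i) <= C.
  rewrite (le_trans (leC _))// ler_piMr// [leLHS]mx_normrE.
  apply/bigmax_leP; split => // -[a b] _ /=.
  by rewrite mxE; case: (_ && _); rewrite ?normr1 ?normr0.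
have H (v : 'rV[R]_n) : v 0 i <= C * dual_norm nrm v.
  rewrite -dotd (le_trans (dot_le_dual_norm _ _))// mulrC.
  by rewrite ler_wpM2r// dual_norm_ge0.
have := H (- x); rewrite dual_normN mxE => Hn.
by rewrite ler_norml H andbT lerNl Hn.
Qed.

End norm.

(** * Bregman divergence and the prox map *)

Section convex_combination.
Context {R : realType} {n : nat} (X : set 'rV[R]_n) (Xconvex : convex_set X).

Lemma convex_set_segment x u (t : R) :
  X x -> X u -> 0 <= t -> t <= 1 -> X (x + t *: (u - x)).
Proof.
move=> Xx Xu t0 t1.
have := @Xconvex u x (Itv01 t0 t1) (mem_set Xu) (mem_set Xx); rewrite inE.
suff -> : x + t *: (u - x) = t *: u + (1 - t) *: x by [].
by rewrite scalerBr scalerBl scale1r addrCA.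
Qed.

Lemma weighted_average_in (S : Type) (gamma : nat -> R)
    (y : nat -> S -> 'rV[R]_n) (T : nat) (w : S) :
  (forall t, 0 < gamma t) -> (forall t, X (y t.+1 w)) ->
  X (weighted_average gamma y T w).
Proof.
move=> g0 Xy; rewrite /weighted_average.
elim: T => [|T IH].
  by rewrite !big_nat1 scalerA mulVf ?scale1r// gt_eqF.
set s := \sum_(0 <= t < T.+1) gamma t in IH.
set v := \sum_(0 <= t < T.+1) gamma t *: y t.+1 w in IH.
have s0 : 0 < s.
  by rewrite /s big_nat_recr//= ltr_wpDl// sumr_ge0// => i _; exact: ltW.
rewrite (big_nat_recr T.+1)//= (big_nat_recr T.+1)//= -/s -/v.
have sg0 : 0 < s + gamma T.+1 by rewrite addr_gt0.
(* The new average lies on the segment from the old average to the new point, at the fraction given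
   by the relative size of the last weight. *)
have -> : (s + gamma T.+1)^-1 *: (v + gamma T.+1 *: y T.+2 w) =
    s^-1 *: v + (gamma T.+1 / (s + gamma T.+1)) *: (y T.+2 w - s^-1 *: v).
  rewrite scalerBr addrCA scalerDr addrC scalerA [_^-1 * _]mulrC; congr (_ + _).
  rewrite scalerA -scalerBl; congr (_ *: _).
  by field; rewrite !gt_eqF.
apply: convex_set_segment => //.
  by rewrite divr_ge0// ltW.
by rewrite ler_pdivrMr// mul1r lerDr ltW.
Qed.

End convex_combination.

Section bregman_prox.
Context {R : realType} {n : nat} {nrm : 'rV[R]_n -> R} (nrmP : is_norm nrm).
Context (X : set 'rV[R]_n) (X0 : X !=set0) (Xclosed : closed X).
Context (Xconvex : convex_set X) (Xbounded : bounded_set X).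
Context (psi : 'rV[R]_n -> R) (gpsi : 'rV[R]_n -> 'rV[R]_n) (alpha : R).
Context (psiC1 : C1_on X psi gpsi) (alpha0 : 0 < alpha).
Context (psi_sc : strongly_convex_on nrm X psi gpsi alpha).
Local Notation B := (bregman psi gpsi).

Lemma bregman_ge x z : X x -> X z -> alpha / 2 * nrm (z - x) ^+ 2 <= B z x.
Proof. by move=> Xx Xz; have := psi_sc Xx Xz; rewrite /bregman; lra. Qed.

Lemma bregman_ge0 x z : X x -> X z -> 0 <= B z x.
Proof.
move=> Xx Xz; apply: le_trans (bregman_ge Xx Xz).
by rewrite mulr_ge0 ?sqr_ge0// divr_ge0// ltW.
Qed.

(** First-order optimality: compare [x] with nearby points of the segment towards [u], which stays
    in [X], and expand [psi] to first order relative to [X]. *)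
Lemma argmin_variational (p x u : 'rV[R]_n) :
  is_argmin X (fun z => dot p z + psi z) x -> X u ->
  0 <= dot (p + gpsi x) (u - x).
Proof.
move=> [Xx xmin] Xu; have [psid _] := psiC1.
suff H e : 0 < e -> 0 <= dot (p + gpsi x) (u - x) + e * `|u - x|.
  rewrite leNgt; apply/negP => d0.
  have K0 : 0 < `|u - x| + 1 by rewrite ltr_wpDl.
  have e0 : 0 < - dot (p + gpsi x) (u - x) / (`|u - x| + 1) / 2.
    by rewrite !divr_gt0// oppr_gt0.
  have := H _ e0; set q := dot _ _ in d0 *.
  suff : - q / (`|u - x| + 1) / 2 * `|u - x| < - q by lra.
  rewrite mulrAC ltr_pdivrMr// mulrAC ltr_pdivrMr//.
  by have := normr_ge0 (u - x); nra.
move=> e0; have /nbhs_ballP[r /= r0 rP] := psid x Xx e e0.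
have K0 : 0 < `|u - x| + 1 by rewrite ltr_wpDl.
(* At most 1 to stay on the segment, and small enough to land in the ball where the expansion of
   [psi] has error [e]; the [+ 1] guards against [u = x]. *)
pose t := Num.min 1 (r / (`|u - x| + 1) / 2).
have t0 : 0 < t by rewrite /t lt_min ltr01 !divr_gt0.
have t1 : t <= 1 by rewrite /t ge_min lexx.
have tr : t * `|u - x| < r.
  have : t <= r / (`|u - x| + 1) / 2 by rewrite /t ge_min lexx orbT.
  rewrite ler_pdivlMr// ler_pdivlMr// => tr.
  have := normr_ge0 (u - x); nra.
have [z Xz zx] : exists2 z, X z & z - x = t *: (u - x).
  exists (x + t *: (u - x)); last by rewrite addrAC subrr add0r.
  by apply: convex_set_segment => //; exact: ltW.
have bz : ball x r z.
  by rewrite -ball_normE /= distrC zx normrZ gtr0_norm.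
have psiz : psi z - psi x - dot (gpsi x) (z - x) <= e * `|z - x|.
  exact/ler_normlW/(rP z bz Xz).
have dpz : dot p z = dot p x + t * dot p (u - x).
  by rewrite -dotZr -zx -dotDr addrC subrK.
have := xmin z Xz; rewrite dpz => xz.
move: psiz; rewrite zx dotZr normrZ gtr0_norm// => psiz.
rewrite -(pmulr_rge0 _ t0) mulrDr (dotDl p) mulrDr [t * (e * _)]mulrCA; lra.
Qed.

(** The right-hand side equals the pairing of [gpsi x' - gpsi x] with [u - x'], so this is the
    optimality inequality at [x']. *)
Lemma prox_three_point (g x x' u : 'rV[R]_n) : X u ->
  is_argmin X (prox_objective psi gpsi g x) x' ->
  dot g (x' - u) <= B u x - B u x' - B x' x.
Proof.
move=> Xu /argmin_variational /(_ Xu).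
rewrite /bregman !(dotDl, dotDr, dotNl, dotNr); lra.
Qed.

(** Complete the square. The weights make the quadratic term match the lower bound [bregman_ge], so
    that a divergence can absorb it. *)
Lemma scaled_young (k : R) (v z : 'rV[R]_n) : 0 <= k ->
  k * dot v z <= k ^+ 2 * dual_norm nrm v ^+ 2 / (2 * alpha) +
                 alpha / 2 * nrm z ^+ 2.
Proof.
move=> k0; apply: (@le_trans _ _ (k * (dual_norm nrm v * nrm z))).
  by rewrite ler_wpM2l// dot_le_dual_norm.
rewrite -subr_ge0.
have -> : k ^+ 2 * dual_norm nrm v ^+ 2 / (2 * alpha) +
    alpha / 2 * nrm z ^+ 2 - k * (dual_norm nrm v * nrm z) =
    (k * dual_norm nrm v - alpha * nrm z) ^+ 2 / (2 * alpha).
  by field; rewrite gt_eqF.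
by rewrite divr_ge0 ?sqr_ge0// mulr_ge0// ltW.
Qed.

(** The three-point bound controls [x' - u]; the remaining pairing with [x - x'] is split by Young
    into the last term and a square absorbed by [B x' x]. *)
Lemma mirror_step (k : R) (e x x' u : 'rV[R]_n) : 0 <= k -> X x -> X u ->
  is_argmin X (prox_objective psi gpsi (k *: e) x) x' ->
  k * dot e (x - u) <=
  B u x - B u x' + k ^+ 2 * dual_norm nrm e ^+ 2 / (2 * alpha).
Proof.
move=> k0 Xx Xu x'min; have [Xx' _] := x'min.
have := prox_three_point Xu x'min.
have := bregman_ge Xx Xx'.
have := scaled_young e (x - x') k0.
rewrite -(is_normN nrmP (x - x')) opprB.
rewrite !dotZl !(dotDr, dotNr); lra.
Qed.

(* Popov's step: [y'] extrapolates with the old sample [g0], [x'] moves with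
   the new one [g1]. *)
Lemma extrapolation_step (k : R) (g0 g1 x x' y' u : 'rV[R]_n) :
  0 <= k -> X x -> X u ->
  is_argmin X (prox_objective psi gpsi (k *: g0) x) y' ->
  is_argmin X (prox_objective psi gpsi (k *: g1) x) x' ->
  k * dot g1 (y' - u) <=
  B u x - B u x' + k ^+ 2 * dual_norm nrm (g1 - g0) ^+ 2 / (2 * alpha).
Proof.
move=> k0 Xx Xu y'min x'min; have [Xx' _] := x'min; have [Xy' _] := y'min.
(* Split the pairing of [g1] with [y' - u] into [g1] with [x' - u], [g0] with [y' - x'] and
   [g1 - g0] with [y' - x']. The step to [x'] is tested at [u] and the step to [y'] at [x']: the
   terms [B x' x] cancel, and [B x' y'] absorbs the square from Young. *)
have := prox_three_point Xu x'min.
have := prox_three_point Xx' y'min.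
have := bregman_ge0 Xx Xy'.
have := bregman_ge Xy' Xx'.
have := scaled_young (g1 - g0) (y' - x') k0.
rewrite -(is_normN nrmP (y' - x')) opprB.
rewrite !dotZl !(dotDr, dotNr, dotDl, dotNl); lra.
Qed.

Lemma C1_on_continuous : {within X, continuous psi}.
Proof.
have [psid _] := psiC1.
apply/subspace_continuousP => x Xx; apply/cvgrPdist_le => e e0.
pose C := 1 + n%:R * `|gpsi x|.
have C0 : 0 < C by rewrite ltr_wpDr.
have := psid x Xx 1 ltr01.
have : \forall z \near within X (nbhs x), `|z - x| <= e / C.
  apply: (cvg_within); apply: (filterS _ (nbhsx_ballx x (e / C) _)); last first.
    by rewrite divr_gt0.
  by move=> z /=; rewrite -ball_normE /= distrC => /ltW.
apply: filterS2 => z; rewrite mul1r ler_pdivlMr// => zx psiz.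
have := normr_dot_le (gpsi x) (z - x); set q := dot _ _ in psiz * => dz.
have : `|psi x - psi z| <= `|psi z - psi x - q| + `|q|.
  by rewrite distrC -{1}(subrK q (psi z - psi x)) ler_normD.
have : `|z - x| * C = `|z - x| + n%:R * `|gpsi x| * `|z - x| by rewrite /C; ring.
lra.
Qed.

Lemma argmin_exists (p : 'rV[R]_n) :
  exists x, is_argmin X (fun z => dot p z + psi z) x.
Proof.
have dotc : continuous (dot p : 'rV[R]_n -> R).
  apply: (@dist_le_continuous _ _ _ _ (n%:R * `|p|)) => [|x z].
    exact: mulr_ge0.
  by rewrite -dotNr -dotDr normr_dot_le.
have fc : {within X, continuous (fun z => dot p z + psi z)}.
  move=> x; apply: cvgD; last exact: C1_on_continuous.
  exact: continuous_subspaceT.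
have [x] := EVT_min_rV X0 (bounded_closed_compact Xbounded Xclosed) fc.
rewrite inE => Xx xmin; exists x; split => // u Xu.
by apply: xmin; rewrite inE.
Qed.

(** The minimiser exists and is unique, so iterates specified only as minimisers are values of this
    one map, whose continuity yields their measurability. *)
Definition prox (p : 'rV[R]_n) : 'rV[R]_n :=
  get (is_argmin X (fun z => dot p z + psi z)).

Lemma proxP p : is_argmin X (fun z => dot p z + psi z) (prox p).
Proof. exact: (getPex (argmin_exists p)). Qed.

(** Add the optimality inequalities of each minimiser tested at the other, then strong convexity in
    both directions. Equal [p] and [p'] give uniqueness; in general it gives Lipschitz dependence on
    [p]. *)
Lemma argmin_monotone (p p' x x' : 'rV[R]_n) :
  is_argmin X (fun z => dot p z + psi z) x ->
  is_argmin X (fun z => dot p' z + psi z) x' ->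
  alpha * nrm (x' - x) ^+ 2 <= dot (p - p') (x' - x).
Proof.
move=> xmin x'min; have [Xx _] := xmin; have [Xx' _] := x'min.
have := argmin_variational xmin Xx'; have := argmin_variational x'min Xx.
have := bregman_ge Xx Xx'; have := bregman_ge Xx' Xx.
rewrite -(is_normN nrmP (x - x')) opprB /bregman.
rewrite !(dotDr, dotNr, dotDl, dotNl); lra.
Qed.

Lemma argmin_prox p x : is_argmin X (fun z => dot p z + psi z) x -> x = prox p.
Proof.
move=> xmin; have := argmin_monotone (proxP p) xmin.
rewrite subrr dotC dot0r => H; apply/eqP; rewrite -subr_eq0; apply/eqP.
apply: (is_norm_eq0 nrmP); apply/eqP; rewrite -sqrf_eq0 eq_le sqr_ge0 andbT.
by rewrite -(pmulr_rle0 _ alpha0).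
Qed.

Lemma prox_continuous : continuous prox.
Proof.
have [k k0 lek] := norm_le_is_norm nrmP.
pose C := k ^+ 2 * n%:R / alpha + 1.
have C0 : 0 < C by rewrite ltr_wpDl// divr_ge0 ?mulr_ge0 ?sqr_ge0// ltW.
have lip p p' : `|prox p - prox p'| <= C * `|p - p'|.
  set v := prox p - prox p'.
  have [->|v0] := eqVneq v 0; first by rewrite normr0 mulr_ge0// ltW.
  have := argmin_monotone (proxP p') (proxP p); rewrite -/v => H.
  have := le_trans H (le_trans (ler_norm _) (normr_dot_le _ _)) => {}H.
  have {}H : alpha * `|v| ^+ 2 <= k ^+ 2 * (n%:R * `|p' - p| * `|v|).
    have k2 : `|v| ^+ 2 <= k ^+ 2 * nrm v ^+ 2.
      rewrite -exprMn lerXn2r ?nnegrE ?lek//.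
      by rewrite mulr_ge0 ?(is_norm_ge0 nrmP)// ltW.
    apply: le_trans (ler_wpM2l (ltW alpha0) k2) _.
    by rewrite mulrCA ler_wpM2l ?sqr_ge0.
  have nv0 : 0 < `|v| by rewrite normr_gt0.
  have {}H : alpha * `|v| <= k ^+ 2 * n%:R * `|p' - p|.
    by rewrite -(ler_pM2r nv0); move: H; rewrite expr2 !mulrA.
  rewrite /C mulrDl mul1r ler_wpDr// (distrC p) mulrAC ler_pdivlMr//.
  by rewrite mulrC.
exact: dist_le_continuous (ltW C0) lip.
Qed.

End bregman_prox.

(** * Pathwise regret *)

Section regret.
Context {R : realType} {n : nat} {nrm : 'rV[R]_n -> R} (nrmP : is_norm nrm).
Context (X : set 'rV[R]_n) (Xconvex : convex_set X).
Context (psi : 'rV[R]_n -> R) (gpsi : 'rV[R]_n -> 'rV[R]_n) (alpha : R).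
Context (psiC1 : C1_on X psi gpsi) (alpha0 : 0 < alpha).
Context (psi_sc : strongly_convex_on nrm X psi gpsi alpha).
Context (F : 'rV[R]_n -> 'rV[R]_n) (Fmono : monotone_on X F).
Context (D : R) (Dbound : forall x z, X x -> X z -> bregman psi gpsi z x <= D).
Context (A : R).
Context (Fosc : forall x z, X x -> X z -> dual_norm nrm (F x - F z) <= A).
Context (gamma : nat -> R) (gamma0 : forall t, 0 < gamma t).
Context (x y u g : nat -> 'rV[R]_n) (Xx0 : X (x 0%N)) (y0 : X (y 0%N)).
Context (yE : forall t,
  is_argmin X (prox_objective psi gpsi (gamma t *: g t) (x t)) (y t.+1)).
Context (xE : forall t,
  is_argmin X (prox_objective psi gpsi (gamma t *: g t.+1) (x t)) (x t.+1)).
Let e t := g t - F (y t).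
Context (u0 : u 0%N = x 0%N).
Context (uE : forall t,
  is_argmin X (prox_objective psi gpsi (gamma t *: - e t.+1) (u t)) (u t.+1)).
Local Notation B := (bregman psi gpsi).

Let Xx t : X (x t). Proof. by case: t => [//|t]; have [] := xE t. Qed.
Let Xy t : X (y t). Proof. by case: t => [//|t]; have [] := yE t. Qed.
Let Xu t : X (u t).
Proof. by case: t => [|t]; [rewrite u0|have [] := uE t]. Qed.

(** If both squared noises have mean at most [sigma ^+ 2], this averages to at most
    [2 * A ^+ 2 + 9 * sigma ^+ 2]. *)
Definition noise_bound t : R := 2 * A ^+ 2 +
  5 * dual_norm nrm (e t.+1) ^+ 2 + 4 * dual_norm nrm (e t) ^+ 2.

Lemma sample_increment_le t :
  dual_norm nrm (g t.+1 - g t) ^+ 2 + dual_norm nrm (e t.+1) ^+ 2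
  <= noise_bound t.
Proof.
have : dual_norm nrm (g t.+1 - g t) <=
    A + dual_norm nrm (e t.+1) + dual_norm nrm (e t).
  have -> : g t.+1 - g t = (F (y t.+1) - F (y t) + e t.+1) + - e t.
    by apply/rowP => i; rewrite /e !mxE; ring.
  apply: le_trans (dual_normD nrmP _ _) _; rewrite dual_normN// lerD2r.
  by apply: le_trans (dual_normD nrmP _ _) _; rewrite lerD2r Fosc.
rewrite /noise_bound; set p := dual_norm nrm (g _ - _).
set q := dual_norm nrm (e t.+1); set r := dual_norm nrm (e t) => pqr.
have p0 : 0 <= p := dual_norm_ge0 nrmP _.
have : p ^+ 2 <= (A + q + r) ^+ 2 by rewrite lerXn2r ?nnegrE// (le_trans p0).
(* The first square bounds [(A + q + r) ^+ 2] by [2 * A ^+ 2 + 2 * (q + r) ^+ 2], the second bounds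
   the last term by [4 * q ^+ 2 + 4 * r ^+ 2]; the fifth [q ^+ 2] is the ghost step's. *)
have := sqr_ge0 (A - q - r); have := sqr_ge0 (q - r); nra.
Qed.

Lemma popov_step t z : X z ->
  gamma t * dot (F z) (y t.+1 - z) <=
  (B z (x t) - B z (x t.+1)) + (B z (u t) - B z (u t.+1)) +
  gamma t ^+ 2 * noise_bound t / (2 * alpha) -
  gamma t * dot (e t.+1) (y t.+1 - u t).
Proof.
move=> Xz; have g0 := ltW (gamma0 t).
have := extrapolation_step nrmP Xconvex psiC1 alpha0 psi_sc g0 (Xx t) Xz (yE t) (xE t).
have := mirror_step nrmP Xconvex psiC1 alpha0 psi_sc g0 (Xu t) Xz (uE t).
rewrite dual_normN//.
have : gamma t ^+ 2 * dual_norm nrm (g t.+1 - g t) ^+ 2 / (2 * alpha) +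
    gamma t ^+ 2 * dual_norm nrm (e t.+1) ^+ 2 / (2 * alpha) <=
    gamma t ^+ 2 * noise_bound t / (2 * alpha).
  rewrite -mulrDl -mulrDr ler_pM2r ?invr_gt0 ?mulr_gt0//.
  by rewrite ler_wpM2l ?sqr_ge0 ?sample_increment_le.
(* Monotonicity moves the operator from the comparison point to the iterate, where it was
   sampled. *)
have : gamma t * dot (F z) (y t.+1 - z) <= gamma t * dot (F (y t.+1)) (y t.+1 - z).
  by rewrite ler_wpM2l// -subr_ge0 -dotNl -dotDl Fmono.
(* The noise is split at [u t]: the part against [u t - z] is paid for by the ghost step, and the
   part left over does not involve [z]. *)
have -> : dot (F (y t.+1)) (y t.+1 - z) = dot (g t.+1) (y t.+1 - z)
    + dot (- e t.+1) (u t - z) - dot (e t.+1) (y t.+1 - u t).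
  by rewrite /e !(dotDl, dotDr, dotNl, dotNr); ring.
rewrite !mulrDr mulrN; lra.
Qed.

(** Both sequences telescope. Each initial divergence is at most [D], and the final ones are dropped
    as nonnegative. *)
Lemma popov_regret T z : X z ->
  \sum_(0 <= t < T.+1) gamma t * dot (F z) (y t.+1 - z) <=
  2 * D + \sum_(0 <= t < T.+1) gamma t ^+ 2 * noise_bound t / (2 * alpha)
  - \sum_(0 <= t < T.+1) gamma t * dot (e t.+1) (y t.+1 - u t).
Proof.
move=> Xz.
have H m : \sum_(0 <= t < m) gamma t * dot (F z) (y t.+1 - z) <=
    (B z (x 0%N) - B z (x m)) + (B z (u 0%N) - B z (u m)) +
    \sum_(0 <= t < m) gamma t ^+ 2 * noise_bound t / (2 * alpha)
    - \sum_(0 <= t < m) gamma t * dot (e t.+1) (y t.+1 - u t).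
  elim: m => [|m IH]; first by rewrite !big_nil !subrr !addr0 subrr.
  by rewrite !big_nat_recr//=; have := popov_step m Xz; lra.
apply: le_trans (H T.+1) _.
have := Dbound (Xx 0) Xz; have := Dbound (Xu 0) Xz.
have := bregman_ge0 alpha0 psi_sc (Xx T.+1) Xz.
have := bregman_ge0 alpha0 psi_sc (Xu T.+1) Xz.
lra.
Qed.

End regret.

(** For fixed [z] the gap expression is affine in the point, so at the average it is the weighted
    mean; a bound [K] uniform in [z] survives the supremum. *)
Lemma dual_gap_weighted_average {R : realType} {n : nat} {S : Type}
    (X : set 'rV[R]_n) (F : 'rV[R]_n -> 'rV[R]_n) (gamma : nat -> R)
    (y : nat -> S -> 'rV[R]_n) (T : nat) (w : S) (K : R) :
  (forall t, 0 < gamma t) ->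
  (forall z, X z ->
    \sum_(0 <= t < T.+1) gamma t * dot (F z) (y t.+1 w - z) <= K) ->
  (dual_gap X F (weighted_average gamma y T w) <=
    (K / \sum_(0 <= t < T.+1) gamma t)%:E)%E.
Proof.
move=> g0 HK; apply: ge_ereal_sup => _ [z Xz <-]; rewrite lee_fin.
set s := \sum_(0 <= t < T.+1) gamma t.
have s0 : 0 < s.
  by rewrite /s big_nat_recr//= ltr_wpDl// sumr_ge0// => i _; exact: ltW.
rewrite ler_pdivlMr// mulrC; apply: le_trans (HK z Xz).
rewrite /weighted_average -/s dotDr dotNr dotZr mulrBr mulrA divff ?gt_eqF// mul1r.
rewrite dot_sumr /s mulr_suml -sumrB.
by apply: ler_sum => i _; rewrite dotZr dotDr dotNr mulrBr.
Qed.

(** * Oscillation of the operator and the constant [Dhat] *)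

Section oscillation.
Context {R : realType}.

(** Strong convexity bounds a squared norm, while the growth condition asks for its power [nu]. *)
Lemma powR_le_half (r q nu : R) : 0 <= r -> 0 <= nu -> r ^+ 2 <= q ->
  r `^ nu <= q `^ (nu / 2).
Proof.
move=> r0 nu0 rq.
have -> : r `^ nu = (r ^+ 2) `^ (nu / 2).
  by rewrite -powR_mulrn// -powRrM mulrCA divff ?mulr1// pnatr_eq0.
by rewrite ge0_ler_powR ?nnegrE ?sqr_ge0 ?divr_ge0// (le_trans _ rq) ?sqr_ge0.
Qed.

(** For [nu = 0] the two sides agree. For [nu > 0] the difference is a nonnegative combination of
    squares over [2 * alpha]. *)
Lemma Dhat_ge (nu L M alpha D sigma : R) :
  0 <= nu -> 0 < L -> 0 <= M -> 0 < alpha -> 0 < D ->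
  (2 * (L * (2 * D / alpha) `^ (nu / 2) + M) ^+ 2 + 9 * sigma ^+ 2)
    / (2 * alpha) <= Dhat nu L M alpha D sigma.
Proof.
move=> nu0 L0 M0 a0 D0; rewrite /Dhat; case: ifPn => [nup|]; last first.
  rewrite -leNgt => nu0'; have -> : nu = 0 by apply/eqP; rewrite eq_le nu0 nu0'.
  by rewrite mul0r powRr0 mulr1 addrC.
set Q := _ `^ (nu / 2).
have QE : 2 `^ (2 + nu) * L ^+ 2 * D `^ nu / alpha `^ (1 + nu) =
    4 * L ^+ 2 * Q ^+ 2 / alpha.
  have -> : Q ^+ 2 = 2 `^ nu * D `^ nu / alpha `^ nu.
    rewrite -powR_mulrn ?powR_ge0// -powRrM mulfVK ?pnatr_eq0//.
    rewrite powRM ?mulr_ge0 ?invr_ge0 ?(ltW a0) ?(ltW D0)//.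
    by rewrite powRM ?(ltW D0)// -powR_inv1 ?(ltW a0)// -powRrM mulN1r powRN.
  rewrite !powRD ?pnatr_eq0 ?implybT ?(gt_eqF a0) ?implybT//.
  rewrite !powRr1 ?(ltW a0)//.
  by field; rewrite !gt_eqF// powR_gt0.
rewrite QE -subr_ge0.
have -> : 4 * L ^+ 2 * Q ^+ 2 / alpha +
    (17 * sigma ^+ 2 + 16 * M ^+ 2) / (2 * alpha) -
    (2 * (L * Q + M) ^+ 2 + 9 * sigma ^+ 2) / (2 * alpha) =
    (4 * (L * Q) ^+ 2 + 2 * (L * Q - M) ^+ 2 + 8 * sigma ^+ 2 + 12 * M ^+ 2)
      / (2 * alpha).
  by field; rewrite gt_eqF.
rewrite divr_ge0 ?mulr_ge0 ?(ltW a0)//.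
by rewrite !addr_ge0// mulr_ge0// sqr_ge0.
Qed.

End oscillation.

(** * Step sizes *)

Section step_sizes.
Context {R : realType}.
Implicit Types (p q r s : R).

Lemma powR_div s r q : 0 <= s -> 0 < r -> (s / r) `^ q = s `^ q / r `^ q.
Proof.
move=> s0 r0; rewrite powRM ?invr_ge0// ?(ltW r0)//; congr (_ * _).
by rewrite -(powR_inv1 (ltW r0)) -powRrM mulN1r powRN.
Qed.

Lemma ln_le_sub1 s : 0 < s -> ln s <= s - 1.
Proof.
move=> s0; have := @le_ln1Dx R (s - 1).
by rewrite addrCA subrr addr0 ltrBrDl addrN; apply.
Qed.

(** Bernoulli's inequality: a concave power lies below its tangent at 1. Taken at a ratio of
    consecutive integers, it replaces integral comparison in the sums below. *)
Lemma powR_le_tangent s q : 0 < s -> 0 <= q -> q <= 1 ->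
  s `^ q <= 1 + q * (s - 1).
Proof.
move=> s0 q0 q1; rewrite /powR gt_eqF//.
set t := q * ln s; have et := expR_gt0 t.
(* Average the tangent line of exp at [q ln s] over the points [0] and [ln s]. *)
have tangent v : expR t * (1 + (v - t)) <= expR v.
  have -> : expR v = expR t * expR (v - t) by rewrite -expRD addrC subrK.
  by rewrite ler_pM2l// expR_ge1Dx.
have := tangent 0; rewrite expR0 => h0.
have := tangent (ln s); rewrite lnK ?posrE// => h1.
have : (1 - q) * (expR t * (1 + (0 - t))) + q * (expR t * (1 + (ln s - t)))
    <= (1 - q) * 1 + q * s.
  by rewrite lerD// ler_wpM2l// subr_ge0.
have -> : (1 - q) * (expR t * (1 + (0 - t))) +
    q * (expR t * (1 + (ln s - t))) = expR t.
  by rewrite /t; ring.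
lra.
Qed.

Lemma powR_ge_tangent s q : 0 < s -> q <= 0 -> 1 + q * (s - 1) <= s `^ q.
Proof.
move=> s0 q0; rewrite /powR gt_eqF//.
apply: le_trans (expR_ge1Dx _); rewrite lerD2l.
by rewrite ler_wnM2l// ln_le_sub1.
Qed.

Lemma sum_powR_lt1 p (N : nat) : 0 < p -> p < 1 ->
  \sum_(0 <= t < N.+1) (t.+1%:R : R) `^ (- p) <= N.+1%:R `^ (1 - p) / (1 - p).
Proof.
move=> p0 p1; have q0 : 0 < 1 - p by rewrite subr_gt0.
elim: N => [|N IH].
  by rewrite big_nat1 !powR1 ler_pdivlMr// mul1r gerBl ltW.
rewrite big_nat_recr//=; apply: le_trans (lerD IH (lexx _)) _.
have q1 : 1 - p <= 1 by rewrite gerBl ltW.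
set m : R := N.+1%:R; set M : R := N.+2%:R.
have m0 : 0 < m by []. have M0 : 0 < M by [].
have mM : m = M - 1 by rewrite /m /M -[N.+2]addn1 natrD addrK.
have := @powR_le_tangent (m / M) (1 - p) (divr_gt0 m0 M0) (ltW q0) q1.
rewrite powR_div ?(ltW m0)// ler_pdivrMr ?powR_gt0// => h.
have -> : M `^ (- p) = M `^ (1 - p) / M.
  rewrite powRD ?(gt_eqF M0) ?implybT// powRr1 ?(ltW M0)// mulrAC.
  by rewrite divff ?mul1r// gt_eqF.
rewrite ler_pdivlMr// mulrDl divfK ?gt_eqF//.
apply: le_trans (lerD h (lexx _)) _.
have -> : (1 + (1 - p) * (m / M - 1)) * M `^ (1 - p) =
   M `^ (1 - p) - M `^ (1 - p) / M * (1 - p).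
  by rewrite mM; field; rewrite gt_eqF.
by rewrite subrK.
Qed.

(** Here [ln (m / M) <= m / M - 1 = - M^-1] bounds each term by an increment of the logarithm. *)
Lemma sum_powR_eq1 (N : nat) :
  \sum_(0 <= t < N.+1) (t.+1%:R : R) `^ (- 1) <= 1 + ln N.+1%:R.
Proof.
elim: N => [|N IH]; first by rewrite big_nat1 powR1 ln1 addr0.
rewrite big_nat_recr//=; apply: le_trans (lerD IH (lexx _)) _.
set m : R := N.+1%:R; set M : R := N.+2%:R.
have m0 : 0 < m by []. have M0 : 0 < M by [].
have mM : m = M - 1 by rewrite /m /M -[N.+2]addn1 natrD addrK.
have := ln_le_sub1 (divr_gt0 m0 M0); rewrite ln_div ?posrE//.
have -> : m / M - 1 = - M^-1 by rewrite mM; field; rewrite gt_eqF.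
rewrite powR_inv1 ?(ltW M0)//; move: (M^-1) => V; lra.
Qed.

Lemma sum_powR_gt1 p (N : nat) : 1 < p ->
  \sum_(0 <= t < N.+1) (t.+1%:R : R) `^ (- p) <= p / (p - 1).
Proof.
move=> p1; have q0 : 0 < p - 1 by rewrite subr_gt0.
(* The constant bound is not inductive by itself; the subtracted term leaves room for the tail, with
   equality at [N = 0]. *)
suff : \sum_(0 <= t < N.+1) (t.+1%:R : R) `^ (- p) <=
    p / (p - 1) - N.+1%:R `^ (1 - p) / (p - 1).
  by move/le_trans; apply; rewrite gerBl divr_ge0 ?powR_ge0// ltW.
elim: N => [|N IH].
  by rewrite big_nat1 !powR1 -mulrBl divff// gt_eqF.
rewrite big_nat_recr//=; apply: le_trans (lerD IH (lexx _)) _.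
set m : R := N.+1%:R; set M : R := N.+2%:R.
have m0 : 0 < m by []. have M0 : 0 < M by [].
have mM : m = M - 1 by rewrite /m /M -[N.+2]addn1 natrD addrK.
have q0' : 1 - p <= 0 by rewrite subr_le0 ltW.
have := @powR_ge_tangent (m / M) (1 - p) (divr_gt0 m0 M0) q0'.
rewrite powR_div ?(ltW m0)// ler_pdivlMr ?powR_gt0// => h.
have -> : M `^ (- p) = M `^ (1 - p) / M.
  rewrite powRD ?(gt_eqF M0) ?implybT// powRr1 ?(ltW M0)// mulrAC.
  by rewrite divff ?mul1r// gt_eqF.
have E : (1 + (1 - p) * (m / M - 1)) * M `^ (1 - p) =
   M `^ (1 - p) + M `^ (1 - p) / M * (p - 1).
  by rewrite mM; field; rewrite gt_eqF.
rewrite E in h.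
rewrite -(ler_pM2r q0) mulrDl !mulrBl !divfK ?gt_eqF//.
by move: h; move: (_ * (p - 1)) => V; lra.
Qed.

Section bounds.
Context (c a : R) (c0 : 0 < c) (a0 : 0 < a) (a1 : a < 1).

Lemma step_size_gt0 t : 0 < step_size c a t.
Proof. by rewrite divr_gt0// powR_gt0. Qed.

(** The steps decrease, so each of the [N.+1] terms is at least the last one. *)
Lemma sum_step_size_ge (N : nat) :
  c * N.+1%:R `^ (1 - a) <= \sum_(0 <= t < N.+1) step_size c a t.
Proof.
have n0 : (0 : R) < N.+1%:R by [].
rewrite powRD ?(gt_eqF n0) ?implybT// powRr1// mulrCA powRN -/(step_size c a N).
rewrite mulr_natl -[in leLHS](subn0 N.+1) -sumr_const_nat.
rewrite big_nat_cond [leRHS]big_nat_cond; apply: ler_sum => t /andP[/andP[_ tN] _].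
rewrite ler_pM2l// lef_pV2 ?posrE ?powR_gt0//.
by rewrite ge0_ler_powR ?nnegrE// ?(ltW a0)// ler_nat.
Qed.

Lemma sum_step_sizeX2 (N : nat) :
  \sum_(0 <= t < N.+1) step_size c a t ^+ 2 =
  c ^+ 2 * \sum_(0 <= t < N.+1) (t.+1%:R : R) `^ (- (2 * a)).
Proof.
rewrite mulr_sumr; apply: eq_bigr => t _.
by rewrite /step_size exprMn exprVn powRN (mulrC 2) powRrM powR_mulrn ?powR_ge0.
Qed.

End bounds.
End step_sizes.

(** * Borel measurability of vector-valued maps *)

Section borel_rV_theory.
Context {R : realType}.

Lemma measurable_fun_borel {d} {T : measurableType d} {n : nat}
    (f : T -> 'rV[R]_n) :
  (forall U, open U -> measurable (f @^-1` U)) ->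
  measurable_fun setT (f : T -> borel_rV R n).
Proof.
move=> fU; apply: (@measurability _ _ T (borel_rV R n) setT f (@open 'rV[R]_n)).
  by [].
by move=> _ [U oU <-]; rewrite setTI; exact: fU.
Qed.

Lemma open_borel_measurable {n : nat} (U : set 'rV[R]_n) :
  open U -> measurable (U : set (borel_rV R n)).
Proof. by move=> oU; exact: sub_sigma_algebra. Qed.

Lemma closed_borel_measurable {n : nat} (U : set 'rV[R]_n) :
  closed U -> measurable (U : set (borel_rV R n)).
Proof.
move=> cU; rewrite -(setCK U); apply: measurableC.
by apply: open_borel_measurable; exact: closed_openC.
Qed.

Lemma continuous_borel_measurable {n m : nat} (f : 'rV[R]_n -> 'rV[R]_m) :
  continuous f ->
  measurable_fun setT (f : borel_rV R n -> borel_rV R m).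
Proof.
move=> fc; apply: measurable_fun_borel => U oU.
by apply: open_borel_measurable; move/continuousP : fc; exact.
Qed.

(** The preimage of an open set is the trace on [X] of an open set, and [X] is closed. The form
    relative to [X] suits [gpsi], which is continuous only there. *)
Lemma within_continuous_borel_measurable {n m : nat} (X : set 'rV[R]_n)
    (f : 'rV[R]_n -> 'rV[R]_m) : closed X -> {within X, continuous f} ->
  measurable_fun (X : set (borel_rV R n)) (f : borel_rV R n -> borel_rV R m).
Proof.
move=> cX fc; apply: (@measurability _ _ (borel_rV R n) (borel_rV R m) X f
  (@open 'rV[R]_m)).
  by [].
move=> _ [U oU <-].
have /open_subspaceP[V oV VX] : open (f @^-1` U : set (subspace X)).
  by move/continuousP : fc; exact.
rewrite setIC -VX; apply: measurableI; first exact: open_borel_measurable.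
exact: closed_borel_measurable.
Qed.

Lemma measurable_coord {d} {T : measurableType d} {n : nat}
    (f : T -> 'rV[R]_n) (i : 'I_n) :
  measurable_fun setT (f : T -> borel_rV R n) ->
  measurable_fun setT (fun w => f w 0 i).
Proof.
move=> mf.
apply: (@measurableT_comp _ _ _ _ _ _
  (fun v : borel_rV R n => (v : 'rV[R]_n) 0 i) _ f) => //.
apply: (measurability (@RGenOpens.G R)); first exact: RGenOpens.measurableE.
move=> _ [_ [a [b ->]] <-]; rewrite setTI; apply: open_borel_measurable.
apply: open_comp; last exact: interval_open.
by move=> x _; exact: coord_continuous.
Qed.

Lemma measurable_rV {d} {T : measurableType d} {n : nat}
    (f : T -> 'rV[R]_n) :
  (forall i, measurable_fun setT (fun w => f w 0 i)) ->
  measurable_fun setT (f : T -> borel_rV R n).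
Proof.
move=> mf; apply: measurable_fun_borel => U oU.
(* [U] is the union of the countably many rational boxes it contains. *)
pose box (qr : 'rV[rat]_n * rat) : set 'rV[R]_n :=
  [set v | forall i, `|v 0 i - ratr (qr.1 0 i)| < ratr qr.2].
pose F (qr : 'rV[rat]_n * rat) : set T :=
  [set w | box qr `<=` U /\ box qr (f w)].
have -> : f @^-1` U = \bigcup_qr F qr.
  apply/seteqP; split => [w /= Ufw|w [qr _ [bU bf]]]; last exact: bU.
  have /nbhs_ballP[e /= e0 eU] : nbhs (f w) U by exact: open_nbhs_nbhs.
  (* A rational radius below [e / 2] keeps two points of one box less than [e] apart; the lower end
     [e / 3] only keeps it positive. *)
  have e3 : e / 3 < e / 2 by rewrite ltr_pM2l// ltf_pV2 ?posrE// ltr_nat.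
  have [r] := rat_in_itvoo e3; rewrite in_itv/= => /andP[r1 r2].
  have r0 : (0 : R) < ratr r by rewrite (lt_trans _ r1)// divr_gt0.
  have qP i : exists q : rat, `|f w 0 i - ratr q| < (ratr r : R).
    have [|q] := @rat_in_itvoo R (f w 0 i - ratr r) (f w 0 i + ratr r).
      by rewrite ltrD2l gtrN.
    rewrite in_itv/= => /andP[q1 q2]; exists q.
    by rewrite ltr_norml; apply/andP; split; lra.
  pose q i := sval (cid (qP i)).
  exists (\row_i q i, r) => //; split => [v bv|i].
    apply: eU; split => // i j; rewrite -ball_normE /= ord1.
    have := bv j; have := svalP (cid (qP j)); rewrite -/(q j) /= mxE => h1 h2.
    rewrite -(subrK (ratr (q j)) (f w 0 j)) -addrA.
    apply: le_lt_trans (ler_normD _ _) _; rewrite (distrC (ratr _)); lra.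
  by rewrite /= mxE; exact: (svalP (cid (qP i))).
apply: countable_bigcupT_measurable; first exact: countableP.
move=> qr; have [bU|nbU] := pselect (box qr `<=` U); last first.
  by rewrite (_ : F qr = set0)// -subset0 => w [].
rewrite (_ : F qr = ~` \bigcup_i
   ~` [set w | `|f w 0 i - ratr (qr.1 0 i)| < ratr qr.2]); last first.
  rewrite setC_bigcup; apply/seteqP; split => [w [_ bw] i _|w bw].
    by rewrite setCK; exact: bw.
  by split => // i; have := bw i I; rewrite setCK.
apply: measurableC; apply: countable_bigcupT_measurable.
  exact: countableP.
move=> i; apply: measurableC.
rewrite -[X in measurable X]setTI; apply: measurable_fun_ltr => //.
by apply: measurableT_comp => //; exact: measurable_funB.
Qed.

Lemma measurable_rVZ {d} {T : measurableType d} {n : nat} (k : R)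
    (f : T -> 'rV[R]_n) :
  measurable_fun setT (f : T -> borel_rV R n) ->
  measurable_fun setT ((fun w => k *: f w) : T -> borel_rV R n).
Proof.
move=> mf; apply: measurable_rV => i.
under eq_fun do rewrite mxE.
by apply: measurable_funM => //; exact: measurable_coord.
Qed.

Lemma measurable_rVB {d} {T : measurableType d} {n : nat}
    (f g : T -> 'rV[R]_n) :
  measurable_fun setT (f : T -> borel_rV R n) ->
  measurable_fun setT (g : T -> borel_rV R n) ->
  measurable_fun setT ((fun w => f w - g w) : T -> borel_rV R n).
Proof.
move=> mf mg; apply: measurable_rV => i.
under eq_fun do rewrite !mxE.
by apply: measurable_funB; exact: measurable_coord.
Qed.

End borel_rV_theory.

Section sub_sigma_algebra.
Context {d} {T : measurableType d}.

Lemma measurable_fun_sub_sigma {d'} {T' : measurableType d'}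
    (G G' : set (set T)) (f : T -> T') :
  G `<=` <<s G' >> ->
  measurable_fun setT (f : g_sigma_algebraType G -> T') ->
  measurable_fun setT (f : g_sigma_algebraType G' -> T').
Proof.
move=> GG' mf _ Y mY.
apply: (@smallest_sub _ (sigma_algebra setT) G); [|exact: GG'|exact: mf].
exact: smallest_sigma_algebra.
Qed.

End sub_sigma_algebra.

Lemma measurable_fun_g_sigma {d d'} {S : measurableType d}
    {T' : measurableType d'} (G : set (set S)) (f : S -> T') :
  G `<=` measurable ->
  measurable_fun setT (f : g_sigma_algebraType G -> T') ->
  measurable_fun setT f.
Proof.
move=> Gm mf _ Y mY.
apply: (@smallest_sub _ (sigma_algebra setT) G); [|exact: Gm|exact: mf].
exact: sigma_algebra_measurable.
Qed.

(** * Conditional means *)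

Section mean_upper_bound.
Context {d} {T : measurableType d} {R : realType} (P : probability T R).
Implicit Types (f g : T -> R) (r s : R).

(** Integrability travels with the bound, so that bounds can be added and scaled term by term. *)
Definition mean_le f r : Prop :=
  P.-integrable setT (EFin \o f) /\ (\int[P]_w (f w)%:E <= r%:E)%E.

Lemma mean_le_cst r : mean_le (fun=> r) r.
Proof.
split; first exact: finite_measure_integrable_cst.
by rewrite integral_cst// [X in (_ * X)%E](_ : _ = 1%E) ?mule1//; exact: probability_setT.
Qed.

Lemma mean_leD f g r s :
  mean_le f r -> mean_le g s -> mean_le (fun w => f w + g w) (r + s).
Proof.
move=> [fi fr] [gi gs]; split.
  exact: (integrableD measurableT fi gi).
under eq_integral do rewrite EFinD.
by rewrite (integralD measurableT fi gi) EFinD leeD.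
Qed.

Lemma mean_leZ (k : R) f r :
  0 <= k -> mean_le f r -> mean_le (fun w => k * f w) (k * r).
Proof.
move=> k0 [fi fr]; split; first exact: (integrableZl measurableT k fi).
under eq_integral do rewrite EFinM.
by rewrite (integralZl measurableT fi) EFinM lee_wpmul2l// lee_fin.
Qed.

Lemma mean_le_sum m (f : nat -> T -> R) (r : nat -> R) :
  (forall t, mean_le (f t) (r t)) ->
  mean_le (fun w => \sum_(0 <= t < m) f t w) (\sum_(0 <= t < m) r t).
Proof.
move=> fr; elim: m => [|m IH].
  by under eq_fun do rewrite big_nil; rewrite big_nil; exact: mean_le_cst.
under eq_fun do rewrite big_nat_recr//=; rewrite big_nat_recr//=.
exact: mean_leD.
Qed.

(* The integral of a nonnegative function is a supremum over the simple
   functions below it, hence monotone even for a non-measurable [g]. *)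
Lemma integral_le_mean (g : T -> \bar R) f r : (forall w, 0 <= g w)%E ->
  (forall w, g w <= (f w)%:E)%E -> mean_le f r -> (\int[P]_w g w <= r%:E)%E.
Proof.
move=> g0 gf [_ fr]; apply: le_trans fr.
rewrite !ge0_integralE//; last by move=> w _; exact: le_trans (gf w).
rewrite !patch_setT; apply: le_ereal_sup => _ [h hg <-]; exists h => // w.
exact: le_trans (gf w).
Qed.

End mean_upper_bound.

(** * Orthogonality of centred noise to known bounded factors *)

Section conditional_mean_zero.
Import HBNNSimple.
Context {d} {T : measurableType d} {R : realType} (P : probability T R).
Context (G : set (set T)) (Gmeas : G `<=` measurable).
Local Notation TG := (g_sigma_algebraType G).

Lemma sub_sigma_measurable A : <<s G >> A -> measurable A.
Proof. by apply: smallest_sub; first exact: sigma_algebra_measurable. Qed.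

Context (e : T -> R) (ei : P.-integrable setT (EFin \o e)).
Context (e0 : forall A, <<s G >> A -> (\int[P]_(w in A) (e w)%:E = 0)%E).

(** A simple factor is a finite combination of indicators of sets in the sub-sigma-algebra, on each
    of which [e] integrates to 0. *)
Let nnsfun_mul0 (h : {nnsfun TG >-> R}) :
  P.-integrable setT (fun w => (h w * e w)%:E) /\
  (\int[P]_w (h w * e w)%:E = 0)%E.
Proof.
pose s : seq R := finmap.enum_fset (fset_set (range h)).
have hE w : (h w * e w)%:E =
    \sum_(v <- s) (v%:E * ((EFin \o e) \_ (h @^-1` [set v])) w)%E.
  rewrite (fimfunE h w) fsbig_finite//= -/s mulr_suml -sumEFin.
  apply: eq_bigr => v _; rewrite patchE indicE -mulrA EFinM; congr (_ * _)%E.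
  by case: ifPn => _; rewrite ?mul1r ?mul0r.
have mA v : <<s G >> (h @^-1` [set v]).
  exact: (measurable_sfunP h (measurable_set1 v)).
have iA v : P.-integrable setT
    (fun w => (v%:E * ((EFin \o e) \_ (h @^-1` [set v])) w)%E).
  apply: integrableZl => //; apply/(integrable_mkcond _ (sub_sigma_measurable (mA v))).
  exact: integrableS (sub_sigma_measurable (mA v)) _ ei.
split.
  under [X in P.-integrable _ X]eq_fun do rewrite hE.
  exact: integrable_sum.
under eq_integral do rewrite hE.
rewrite integral_sum// big1// => v _; rewrite integralZl//; last first.
  apply/(integrable_mkcond _ (sub_sigma_measurable (mA v))).
  exact: integrableS (sub_sigma_measurable (mA v)) _ ei.
by rewrite -integral_mkcond e0// mule0.
Qed.

(** Approximate [W] from below by simple functions of the sub-sigma-algebra; dominated convergence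
    applies with dominating function [K] times the modulus of [e]. *)
Let bounded_ge0_mul0 (W : T -> R) (K : R) :
  measurable_fun setT (W : TG -> R) -> (forall w, 0 <= W w <= K) ->
  (\int[P]_w (W w * e w)%:E = 0)%E.
Proof.
move=> mW W0.
have mEW : measurable_fun setT (EFin \o W : TG -> \bar R) by exact/measurable_EFinP.
pose g := nnsfun_approx (@measurableT _ TG) mEW.
have EW0 (x : TG) : [set: TG] x -> (0 <= (EFin \o W) x)%E.
  by move=> _; rewrite lee_fin; have /andP[] := W0 x.
have gW x : EFin \o g^~ x @ \oo --> (W x)%:E.
  exact: (@cvg_nnsfun_approx _ TG R setT measurableT _ mEW EW0 x).
have gle k x : g k x <= W x.
  by rewrite /g nnsfun_approxE -lee_fin; apply: le_approx.
have me : measurable_fun setT e by apply/measurable_EFinP; case/integrableP : ei.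
have mWT : measurable_fun setT W.
  by move=> _ Y mY; apply: sub_sigma_measurable; exact: mW.
have ge0 k x : 0 <= g k x by exact: fun_ge0.
have [|||||_ _] := @dominated_convergence _ T R P setT measurableT
  (fun k w => (g k w * e w)%:E) (fun w => (W w * e w)%:E)
  (fun w => (K%:E * `|(e w)%:E|)%E).
- by move=> k; exact: (measurable_int P (nnsfun_mul0 (g k)).1).
- by apply/measurable_EFinP; exact: measurable_funM.
- apply: aeW => x _; under eq_fun do rewrite EFinM.
  by rewrite EFinM; apply: cvgeZr => //; exact: gW.
- by apply: integrableZl => //; exact: integrable_abse.
- apply: aeW => x k _; rewrite EFinM abseM lee_wpmul2r//.
  rewrite abse_EFin lee_fin ger0_norm// (le_trans (gle k x))//.
  by have /andP[] := W0 x.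
under eq_fun do rewrite (nnsfun_mul0 (g _)).2.
by move/cvg_lim => <- //; rewrite lim_cst.
Qed.

Lemma integral_bounded_mul0 (W : T -> R) (K : R) :
  measurable_fun setT (W : TG -> R) -> (forall w, `|W w| <= K) ->
  P.-integrable setT (fun w => (W w * e w)%:E) /\
  (\int[P]_w (W w * e w)%:E = 0)%E.
Proof.
move=> mW WK.
have me : measurable_fun setT e by apply/measurable_EFinP; case/integrableP : ei.
have mWT : measurable_fun setT W.
  by move=> _ Y mY; apply: sub_sigma_measurable; exact: mW.
have iW (V : T -> R) (C : R) : measurable_fun setT V -> (forall w, `|V w| <= C) ->
    P.-integrable setT (fun w => (V w * e w)%:E).
  move=> mV VC; apply: (le_integrable measurableT _ _ (integrableZl measurableT C ei)).
    by apply/measurable_EFinP; exact: measurable_funM.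
  move=> w _; rewrite !EFinM !abseM lee_wpmul2r// !abse_EFin lee_fin.
  exact: le_trans (VC w) (ler_norm _).
split; first exact: iW WK.
(* Shifting by [K] reduces a signed factor to the nonnegative case. *)
have sumE w : (W w * e w)%:E = (((W w + K) * e w)%R%:E - K%:E * (e w)%:E)%E.
  by rewrite -EFinM -EFinB; congr EFin; ring.
under eq_integral do rewrite sumE.
rewrite integralB//=; last 2 first.
  apply: (iW (fun w => W w + K) (K + K)); first exact: measurable_funD.
  move=> w; apply: le_trans (ler_normD _ _) _; rewrite lerD//.
  by rewrite ger0_norm// (le_trans _ (WK w)).
  exact: integrableZl.
rewrite (@bounded_ge0_mul0 _ (K + K)); last 2 first.
  by apply: measurable_funD.
  move=> w; have := WK w; rewrite ler_norml => /andP[h1 h2].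
  by apply/andP; split; lra.
rewrite integralZl// e0; last exact: (@measurableT _ TG).
by rewrite mule0 sube0.
Qed.


End conditional_mean_zero.

Section conditional_expectation_theory.
Context {d} {T : measurableType d} {R : realType} (P : probability T R).
Context (G : set (set T)) (Gmeas : G `<=` measurable).
Local Notation TG := (g_sigma_algebraType G).

Lemma cond_exp_measurable (f h : T -> \bar R) : is_cond_exp P G f h ->
  measurable_fun setT (h : TG -> \bar R).
Proof. by move=> [_ hG _] _ Y mY; apply: hG; exists Y. Qed.

Lemma cond_exp_measurableT (f h : T -> \bar R) : is_cond_exp P G f h ->
  measurable_fun setT h.
Proof.
by move=> fh; apply: measurable_fun_g_sigma Gmeas _; exact: cond_exp_measurable fh.
Qed.

Lemma cond_exp_integral (f h : T -> \bar R) : is_cond_exp P G f h ->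
  (\int[P]_w h w = \int[P]_w f w)%E.
Proof. by move=> [_ _]; apply; exact: (@measurableT _ TG). Qed.

(** The nonnegative alternative in [is_cond_exp] would allow an infinite integral; a bounded version
    excludes it, since [f] and [h] have the same total integral. *)
Lemma cond_exp_bounded_integrable (f : T -> \bar R) (h : T -> R) (C : R) :
  is_cond_exp P G f (EFin \o h) -> (forall w, `|h w| <= C) ->
  P.-integrable setT (EFin \o h) /\ P.-integrable setT f.
Proof.
move=> fh hC.
have ih : P.-integrable setT (EFin \o h).
  apply: (@le_integrable _ T R P setT measurableT _ (EFin \o cst C)).
  - exact: cond_exp_measurableT fh.
  - by move=> w _ /=; rewrite lee_fin (le_trans (hC w))// ler_norm.
  - exact: finite_measure_integrable_cst.
split => //; have [[//|[mf f0]] _ _] := fh; apply/integrableP; split => //.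
under eq_integral do rewrite gee0_abs//.
by rewrite -(cond_exp_integral fh) (integrable_lty measurableT ih).
Qed.

Lemma cond_exp_sub0 (f h : T -> R) (C : R) :
  is_cond_exp P G (EFin \o f) (EFin \o h) -> (forall w, `|h w| <= C) ->
  P.-integrable setT (EFin \o (fun w => f w - h w)) /\
  forall A, <<s G >> A -> (\int[P]_(w in A) (f w - h w)%:E = 0)%E.
Proof.
move=> fh hC; have [ih if_] := cond_exp_bounded_integrable fh hC.
split; first exact: (integrableB measurableT if_ ih).
move=> A mA; have mA' := sub_sigma_measurable Gmeas mA.
have ihA : P.-integrable A (EFin \o h) by exact: integrableS ih.
have ifA : P.-integrable A (EFin \o f) by exact: integrableS if_.
under eq_integral do rewrite EFinB.
rewrite (integralB mA' ifA ihA); have [_ _ ->//] := fh.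
by rewrite subee// integrable_fin_num.
Qed.

Lemma cond_exp_mean_le (f : T -> R) (h : T -> \bar R) (s : R) : 0 <= s ->
  (forall w, 0 <= f w) -> is_cond_exp P G (EFin \o f) h ->
  {ae P, forall w, (h w <= s%:E)%E} -> mean_le P f s.
Proof.
move=> s0 f0 fh hs; have mh := cond_exp_measurableT fh.
have fs : (\int[P]_w (f w)%:E <= s%:E)%E.
  rewrite -(cond_exp_integral fh) integralE.
  (* A version [h] may take negative values, so its positive part is what gets compared with the
     constant [s]. *)
  apply: (@le_trans _ _ (\int[P]_w (h^\+ w))%E).
    rewrite -[leRHS]sube0 leeB// integral_ge0//.
  have [_] := mean_le_cst P s; apply: le_trans.
  apply: ae_ge0_le_integral => //.
  - exact: measurable_funepos.
  - by apply: filterS hs => w hw _; rewrite funeposE ge_max hw lee_fin.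
split => //; have [[//|[mf _]] _ _] := fh; apply/integrableP; split => //.
under eq_integral do rewrite /= ger0_norm//.
exact: le_lt_trans fs (ltry _).
Qed.

End conditional_expectation_theory.

(** * The stochastic iterates *)

Section popov_iterates.
Context {d d'} {S : measurableType d} {Om : measurableType d'} {R : realType}.
Context {P : probability S R} {n : nat}.
Context {nrm : 'rV[R]_n -> R} (nrmP : is_norm nrm).
Context (X : set 'rV[R]_n) (X0 : X !=set0) (Xclosed : closed X).
Context (Xconvex : convex_set X) (Xbounded : bounded_set X).
Context (psi : 'rV[R]_n -> R) (gpsi : 'rV[R]_n -> 'rV[R]_n) (alpha : R).
Context (psiC1 : C1_on X psi gpsi) (alpha0 : 0 < alpha).
Context (psi_sc : strongly_convex_on nrm X psi gpsi alpha).
Context (F : 'rV[R]_n -> 'rV[R]_n) (Fhat : 'rV[R]_n -> Om -> 'rV[R]_n).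
Context (Fhat_meas : oracle_measurable X Fhat).
Context (gamma : nat -> R) (xis : nat -> {RV P >-> Om}).
Context (x y : nat -> S -> 'rV[R]_n).
Context (x0_meas : measurable_fun setT (x 0%N : S -> borel_rV R n)).
Context (algo : popov_mirror_prox X psi gpsi Fhat gamma xis x y).
Context (unbiased_y : forall t,
  unbiased_at P (history (x 0%N) xis t) F Fhat (xis t) (y t)).

Local Notation hist t := (history (x 0%N) (fun k => xis k) t).
Local Notation H t := (g_sigma_algebraType (hist t)).

Lemma history_measurable t : hist t `<=` measurable.
Proof.
move=> A [[U mU <-]|[k _ [U mU <-]]]; first exact: x0_meas.
exact: (measurable_funPT (xis k)).
Qed.

Lemma history_mono t : hist t `<=` <<s hist t.+1 >>.
Proof.
move=> A hA; apply: sub_sigma_algebra.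
case: hA => [?|[k /= kt kA]]; [by left|right; exists k => //=].
exact: ltnW.
Qed.

Lemma sample_history_measurable t : measurable_fun setT (xis t : H t.+1 -> Om).
Proof.
move=> _ Y mY; apply: sub_sigma_algebra; right; exists t => /=; first exact: ltnSn.
by exists Y.
Qed.

Lemma popov_in t w : X (x t w) /\ X (y t w).
Proof.
have [Xx0 y0 yE xE] := algo; case: t => [|t]; first by rewrite y0.
by split; [have [] := xE t w|have [] := yE t w].
Qed.

Definition estimate t w := Fhat (y t w) (xis t w).

Definition noise t w := estimate t w - F (y t w).

(* The point [u_t] of the auxiliary mirror descent started at [x_0]. *)
Fixpoint ghost t w : 'rV[R]_n := if t is t'.+1 then
  prox X psi (gamma t' *: - noise t w - gpsi (ghost t' w)) else x 0%N w.

Lemma ghost_argmin t w :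
  is_argmin X (prox_objective psi gpsi (gamma t *: - noise t.+1 w) (ghost t w))
    (ghost t.+1 w).
Proof. exact: (proxP X0 Xclosed Xbounded psiC1). Qed.

Lemma ghost_in t w : X (ghost t w).
Proof.
case: t => [|t]; first by have [] := popov_in 0 w.
by have [] := ghost_argmin t w.
Qed.

(** Composition goes through [X] as domain, since nothing is known of [gpsi] outside it. *)
Let measurable_grad t (f : S -> 'rV[R]_n) : (forall w, X (f w)) ->
  measurable_fun setT (f : H t -> borel_rV R n) ->
  measurable_fun setT ((fun w => gpsi (f w)) : H t -> borel_rV R n).
Proof.
move=> Xf mf; have [_ gc] := psiC1.
apply: (@measurable_comp _ _ _ (H t) (borel_rV R n) (borel_rV R n) X gpsi setT f) => //.
- exact: closed_borel_measurable.
- by move=> _ [w _ <-]; exact: Xf.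
- exact: within_continuous_borel_measurable.
Qed.

Let measurable_prox t (f : S -> 'rV[R]_n) :
  measurable_fun setT (f : H t -> borel_rV R n) ->
  measurable_fun setT ((fun w => prox X psi (f w)) : H t -> borel_rV R n).
Proof.
move=> mf.
apply: (@measurableT_comp _ _ _ (H t) (borel_rV R n) (borel_rV R n)
  (prox X psi) _ f) => //.
apply: continuous_borel_measurable.
exact: (prox_continuous nrmP X0 Xclosed Xconvex Xbounded psiC1 alpha0 psi_sc).
Qed.

Let estimate_measurable t :
  measurable_fun setT (y t : H t -> borel_rV R n) ->
  measurable_fun setT (estimate t : H t.+1 -> borel_rV R n).
Proof.
move=> my.
apply: (@measurable_comp _ _ _ (H t.+1) (borel_rV R n * Om)%type (borel_rV R n)
  (X `*` setT) (fun p => Fhat p.1 p.2) setT (fun w => (y t w, xis t w))).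
- by apply: measurableX => //; exact: closed_borel_measurable.
- by move=> _ [w _ <-]; split => //=; have [] := popov_in t w.
- exact: Fhat_meas.
- apply: (@measurable_fun_pair _ _ _ (H t.+1) (borel_rV R n) Om).
    exact: measurable_fun_sub_sigma (@history_mono t) my.
  exact: sample_history_measurable.
Qed.

Lemma popov_prox t w :
  y t.+1 w = prox X psi (gamma t *: estimate t w - gpsi (x t w)) /\
  x t.+1 w = prox X psi (gamma t *: estimate t.+1 w - gpsi (x t w)).
Proof.
have [_ _ yE xE] := algo.
split; apply: (argmin_prox nrmP X0 Xclosed Xconvex Xbounded psiC1 alpha0 psi_sc).
  exact: yE.
exact: xE.
Qed.

(** [H t] carries only samples of index below [t]: [y t] is known before [xis t] is drawn, whereas
    [x t] may depend on it. The induction is joint because [y t.+1] is computed from [x t]. *)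
Lemma popov_measurable t :
  measurable_fun setT (y t : H t -> borel_rV R n) /\
  measurable_fun setT (x t : H t.+1 -> borel_rV R n).
Proof.
elim: t => [|t [my mx]].
  have mx0 : measurable_fun setT (x 0%N : H 0 -> borel_rV R n).
    by move=> _ Y mY; apply: sub_sigma_algebra; left; exists Y.
  split; last exact: measurable_fun_sub_sigma (@history_mono 0) mx0.
  by have [_ y0 _ _] := algo; rewrite (_ : y 0%N = x 0%N)//; exact/funext.
have mgx : measurable_fun setT ((fun w => gpsi (x t w)) : H t.+1 -> borel_rV R n).
  by apply: measurable_grad => // w; have [] := popov_in t w.
have my' : measurable_fun setT (y t.+1 : H t.+1 -> borel_rV R n).
  rewrite (_ : y t.+1 = fun w => prox X psi (gamma t *: estimate t w - gpsi (x t w))).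
    apply: measurable_prox; apply: measurable_rVB => //.
    by apply: measurable_rVZ; exact: estimate_measurable.
  by apply/funext => w; have [] := popov_prox t w.
split => //.
rewrite (_ : x t.+1 = fun w => prox X psi (gamma t *: estimate t.+1 w - gpsi (x t w))).
  apply: measurable_prox; apply: measurable_rVB.
    by apply: measurable_rVZ; exact: estimate_measurable.
  exact: measurable_fun_sub_sigma (@history_mono t.+1) mgx.
by apply/funext => w; have [] := popov_prox t w.
Qed.

(** Unbiasedness makes each coordinate of [F (y t)] a version of a conditional expectation given the
    history, which includes its measurability. *)
Lemma operator_measurable t :
  measurable_fun setT ((fun w => F (y t w)) : H t -> borel_rV R n).
Proof.
apply: measurable_rV => i; apply/measurable_EFinP.
exact: (cond_exp_measurable (unbiased_y t i)).
Qed.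

Lemma noise_measurable t :
  measurable_fun setT (noise t : H t.+1 -> borel_rV R n).
Proof.
apply: measurable_rVB; first by apply: estimate_measurable; have [] := popov_measurable t.
exact: measurable_fun_sub_sigma (@history_mono t) (@operator_measurable t).
Qed.

(** [ghost t] uses noises of index at most [t], so it is known before [xis t.+1] is drawn; this
    makes the next noise centred against it. *)
Lemma ghost_measurable t :
  measurable_fun setT (ghost t : H t.+1 -> borel_rV R n).
Proof.
elim: t => [|t IH]; first by have [] := popov_measurable 0.
apply: measurable_prox.
apply: measurable_rVB.
  apply: measurable_rVZ.
  rewrite (_ : (fun w => - noise t.+1 w) = fun w => -1 *: noise t.+1 w).
    by apply: measurable_rVZ; exact: noise_measurable.
  by apply/funext => w; rewrite scaleN1r.
apply: measurable_grad; first exact: ghost_in.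
exact: measurable_fun_sub_sigma (@history_mono t.+1) IH.
Qed.

End popov_iterates.

(** * Expected dual gap *)

Section rates.
Context {R : realType} (c a D C : R).
Context (c0 : 0 < c) (a0 : 0 < a) (a1 : a < 1) (D0 : 0 <= D) (C0 : 0 <= C).
Context (N : nat).
Local Notation n := (N.+1%:R : R).
Let n0 : 0 < n. Proof. by []. Qed.
Let bound : R :=
  (2 * D + C * \sum_(0 <= t < N.+1) step_size c a t ^+ 2)
  / \sum_(0 <= t < N.+1) step_size c a t.

(** Reduces the three regimes to an estimate of one power sum: the numerator is increased through
    [s], the denominator replaced by [sum_step_size_ge]. *)
Let bound_le s : \sum_(0 <= t < N.+1) (t.+1%:R : R) `^ (- (2 * a)) <= s ->
  bound <= 2 * D / (c * n `^ (1 - a)) + C * c * s / n `^ (1 - a).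
Proof.
move=> hs; have S1 := sum_step_size_ge c0 a0 N.
have s0 : 0 < c * n `^ (1 - a) by rewrite mulr_gt0// powR_gt0.
have hs0 : 0 <= s by apply: le_trans hs; apply: sumr_ge0 => i _; exact: powR_ge0.
have -> : 2 * D / (c * n `^ (1 - a)) + C * c * s / n `^ (1 - a) =
    (2 * D + C * (c ^+ 2 * s)) / (c * n `^ (1 - a)).
  by field; rewrite !gt_eqF// powR_gt0.
rewrite /bound sum_step_sizeX2; apply: ler_pM.
- rewrite addr_ge0 ?mulr_ge0 ?(ltW c0)//.
  by apply: sumr_ge0 => i _; exact: powR_ge0.
- by rewrite invr_ge0; apply: le_trans S1; exact: ltW.
- by rewrite lerD2l ler_wpM2l// ler_wpM2l ?sqr_ge0.
- by rewrite lef_pV2 ?posrE// (lt_le_trans s0).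
Qed.

Lemma rate_lt_half : a < 2^-1 ->
  bound <= 2 * D / (c * n `^ (1 - a)) + C * c / ((1 - 2 * a) * n `^ a).
Proof.
move=> a2; have a21 : 2 * a < 1 by lra.
apply: le_trans (bound_le (sum_powR_lt1 N _ a21)) _; first by rewrite mulr_gt0.
rewrite lerD2l.
(* Against the denominator [n]^ (1 - a)[, only the factor]n [^ a] remains below. *)
have -> : n `^ (1 - 2 * a) = n `^ (1 - a) / n `^ a.
  by rewrite -powRN -powRD ?(gt_eqF n0) ?implybT//; congr (_ `^ _); ring.
rewrite le_eqVlt; apply/orP; left; apply/eqP.
by field; rewrite !gt_eqF ?powR_gt0//; lra.
Qed.

Lemma rate_eq_half : a = 2^-1 ->
  bound <= 2 * D / (c * n `^ (1 - a)) + C * c * (1 + ln n) / n `^ (1 - a).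
Proof.
move=> a2; apply: bound_le.
by rewrite (_ : 2 * a = 1) ?sum_powR_eq1// a2 divff// pnatr_eq0.
Qed.

Lemma rate_gt_half : 2^-1 < a ->
  bound <= 2 * D / (c * n `^ (1 - a)) +
           2 * a * C * c / ((2 * a - 1) * n `^ (1 - a)).
Proof.
move=> a2; have a21 : 1 < 2 * a by lra.
apply: le_trans (bound_le (sum_powR_gt1 N a21)) _; rewrite lerD2l.
rewrite le_eqVlt; apply/orP; left; apply/eqP.
by field; rewrite !gt_eqF ?powR_gt0//; lra.
Qed.

End rates.

Section expected_gap.
Context {d d'} {S : measurableType d} {Om : measurableType d'} {R : realType}.
Context {P : probability S R} {n : nat}.
Context {nrm : 'rV[R]_n -> R} (nrmP : is_norm nrm).
Context (X : set 'rV[R]_n) (X0 : X !=set0) (Xclosed : closed X).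
Context (Xconvex : convex_set X) (Xbounded : bounded_set X).
Context (psi : 'rV[R]_n -> R) (gpsi : 'rV[R]_n -> 'rV[R]_n) (alpha : R).
Context (psiC1 : C1_on X psi gpsi) (alpha0 : 0 < alpha).
Context (psi_sc : strongly_convex_on nrm X psi gpsi alpha).
Context (F : 'rV[R]_n -> 'rV[R]_n) (Fhat : 'rV[R]_n -> Om -> 'rV[R]_n).
Context (Fmono : monotone_on X F) (Fhat_meas : oracle_measurable X Fhat).
Context (D : R) (Dbound : forall x z, X x -> X z -> bregman psi gpsi z x <= D).
Context (A : R).
Context (Fosc : forall x z, X x -> X z -> dual_norm nrm (F x - F z) <= A).
Context (gamma : nat -> R) (gamma0 : forall t, 0 < gamma t).
Context (xis : nat -> {RV P >-> Om}) (x y : nat -> S -> 'rV[R]_n).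
Context (x0_meas : measurable_fun setT (x 0%N : S -> borel_rV R n)).
Context (algo : popov_mirror_prox X psi gpsi Fhat gamma xis x y).
Context (unbiased_y : forall t,
  unbiased_at P (history (x 0%N) xis t) F Fhat (xis t) (y t)).
Context (sigma : R) (variance_y : forall t,
  bounded_variance_at P nrm (history (x 0%N) xis t) F Fhat (xis t) (y t) sigma).

Local Notation e t := (noise F Fhat xis y t).
Local Notation u t := (ghost X psi gpsi F Fhat gamma xis x y t).

Lemma mean_noise_sqr t :
  mean_le P (fun w => dual_norm nrm (e t w) ^+ 2) (sigma ^+ 2).
Proof.
have [h hce hs] := variance_y t.
apply: (cond_exp_mean_le (history_measurable x0_meas (t := t)) _ _ hce hs).
  exact: sqr_ge0.
by move=> w; exact: sqr_ge0.
Qed.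

(** Coordinate by coordinate, [y t.+1 - u t] is bounded because [X] is, and is known before
    [xis t.+1] is drawn, so it is orthogonal to the centred noise. *)
Lemma mean_noise_dot t :
  mean_le P (fun w => - dot (e t.+1 w) (y t.+1 w - u t w)) 0.
Proof.
have [k k0 Xk] := ex_strict_bound_gt0 Xbounded.
have [K K0 leK] := coord_le_dual_norm nrmP.
have [z0 Xz0] := X0.
pose W i w := (y t.+1 w - u t w) 0 i.
have Xy w : X (y t.+1 w) by have [] := popov_in algo t.+1 w.
have Xu w : X (u t w) := ghost_in X0 Xclosed Xbounded psiC1 F algo t w.
have WK i w : `|W i w| <= k + k.
  rewrite (le_trans (ler_coord_norm _ _))// (le_trans (ler_normB _ _))//.
  by rewrite lerD// ltW// Xk.
(* Oscillation around a fixed point [z0] bounds the conditional mean, which gives integrability of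
   the noise. *)
have FK i w : `|F (y t.+1 w) 0 i| <= K * A + `|F z0 0 i|.
  rewrite -(subrK (F z0 0 i) (F _ _ _)) (le_trans (ler_normD _ _))// lerD2r.
  have := leK (F (y t.+1 w) - F z0) i; rewrite !mxE => /le_trans; apply.
  by rewrite ler_wpM2l// Fosc.
have mW i : measurable_fun setT
    (W i : g_sigma_algebraType (history (x 0%N) xis t.+1) -> R).
  rewrite /W; under [X in measurable_fun _ X]eq_fun do rewrite !mxE.
  apply: measurable_funB; apply: measurable_coord.
    by have [] := popov_measurable nrmP X0 Xclosed Xconvex Xbounded psiC1 alpha0
      psi_sc Fhat_meas algo t.+1.
  exact: (ghost_measurable nrmP X0 Xclosed Xconvex Xbounded psiC1 alpha0
      psi_sc Fhat_meas algo unbiased_y).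
have Gm := history_measurable (xis := xis) x0_meas (t := t.+1).
have We0 i : P.-integrable setT (fun w => (W i w * e t.+1 w 0 i)%:E) /\
    (\int[P]_w (W i w * e t.+1 w 0 i)%:E = 0)%E.
  have [ei e0] := cond_exp_sub0 Gm (unbiased_y t.+1 i) (FK i).
  have eE w : e t.+1 w 0 i =
      Fhat (y t.+1 w) (xis t.+1 w) 0 i - F (y t.+1 w) 0 i by rewrite !mxE.
  under eq_fun do rewrite eE.
  by have := integral_bounded_mul0 Gm ei e0 (mW i) (WK i).
have sumE w : - dot (e t.+1 w) (y t.+1 w - u t w) =
    - 1 * (\sum_i (W i w * e t.+1 w 0 i)).
  by rewrite mulN1r; congr (- _); apply: eq_bigr => i _; rewrite mulrC.
rewrite /mean_le /comp; under eq_fun do rewrite sumE EFinM -sumEFin.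
have iS : P.-integrable setT
    (fun w => \sum_i (W i w * e t.+1 w 0 i)%:E)%E.
  by apply: integrable_sum => // i _; exact: (We0 i).1.
split; first exact: integrableZl.
rewrite integralZl// integral_sum//; last by move=> i; exact: (We0 i).1.
by rewrite big1 ?mule0// => i _; exact: (We0 i).2.
Qed.

Lemma expected_gap_le T :
  (\int[P]_w dual_gap X F (weighted_average gamma y T w) <=
   ((2 * D + (2 * A ^+ 2 + 9 * sigma ^+ 2) / (2 * alpha) *
       \sum_(0 <= t < T.+1) gamma t ^+ 2)
    / \sum_(0 <= t < T.+1) gamma t)%:E)%E.
Proof.
set s := \sum_(0 <= t < T.+1) gamma t.
have s0 : 0 < s.
  by rewrite /s big_nat_recr//= ltr_wpDl// sumr_ge0// => i _; exact: ltW.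
pose nb t w := @noise_bound R n nrm F A (fun k => y k w)
  (fun k => estimate Fhat xis y k w) t.
pose k t := gamma t ^+ 2 / (2 * alpha).
(* The bound of [popov_regret] over the total weight. It is free of [z], so it dominates the gap
   pathwise and only its mean remains to be estimated. *)
pose f w := s^-1 * (2 * D + \sum_(0 <= t < T.+1) k t * nb t w +
  \sum_(0 <= t < T.+1) gamma t * - dot (e t.+1 w) (y t.+1 w - u t w)).
have mean_f : mean_le P f (s^-1 * (2 * D +
    \sum_(0 <= t < T.+1) k t * (2 * A ^+ 2 + 5 * sigma ^+ 2 + 4 * sigma ^+ 2)
    + \sum_(0 <= t < T.+1) gamma t * 0)).
  apply: mean_leZ; first by rewrite invr_ge0 ltW.
  apply: mean_leD; last first.
    apply: mean_le_sum => t; apply: mean_leZ; first exact: ltW.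
    exact: mean_noise_dot.
  apply: mean_leD; first exact: mean_le_cst.
  apply: mean_le_sum => t; apply: mean_leZ.
    by rewrite divr_ge0 ?sqr_ge0// mulr_ge0// ltW.
  apply: mean_leD; last by apply: mean_leZ => //; exact: mean_noise_sqr.
  apply: mean_leD; last by apply: mean_leZ => //; exact: mean_noise_sqr.
  exact: mean_le_cst.
have -> : (2 * D + (2 * A ^+ 2 + 9 * sigma ^+ 2) / (2 * alpha) *
    \sum_(0 <= t < T.+1) gamma t ^+ 2) / s = s^-1 * (2 * D +
    \sum_(0 <= t < T.+1) k t * (2 * A ^+ 2 + 5 * sigma ^+ 2 + 4 * sigma ^+ 2)
    + \sum_(0 <= t < T.+1) gamma t * 0).
  have -> : \sum_(0 <= t < T.+1) gamma t * 0 = 0.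
    by rewrite big1// => i _; rewrite mulr0.
  rewrite addr0 mulrC mulr_sumr; congr (_ * (_ + _)); apply: eq_bigr => t _.
  by rewrite /k; field; rewrite gt_eqF.
apply: integral_le_mean mean_f => w.
  (* The gap is nonnegative: the average itself lies in [X] and is an admissible comparison point
     with value 0. *)
  have Xa : X (weighted_average gamma y T w).
    apply: weighted_average_in => // t; by have [] := popov_in algo t.+1 w.
  apply: ereal_sup_ubound; exists (weighted_average gamma y T w) => //.
  by rewrite subrr dot0r.
rewrite /f mulrC; apply: dual_gap_weighted_average => // z Xz.
have [Xx0 y0 yE xE] := algo.
have := popov_regret nrmP Xconvex psiC1 alpha0 psi_sc Fmono Dbound Fosc gamma0
  (x := fun t => x t w) (y := fun t => y t w) (u := fun t => u t w)
  (g := fun t => estimate Fhat xis y t w) (Xx0 w) _ _ _ erefl _ T Xz.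
rewrite (y0 w) => /(_ (Xx0 w) (fun t => yE t w) (fun t => xE t w)).
move=> /(_ (fun t => ghost_argmin X0 Xclosed Xbounded psiC1 F Fhat gamma
  xis x y t w)) /le_trans; apply.
rewrite lerD//.
  by rewrite lerD2l; apply: ler_sum => t _; rewrite /k mulrAC.
by rewrite -sumrN; apply: ler_sum => t _; rewrite mulrN.
Qed.

End expected_gap.

(** * Uniform oscillation bound and the three step-size regimes *)

Theorem theorem7 (R : realType) (n : nat)
  (nrm : 'rV[R]_n -> R) (nrm_norm : is_norm nrm)
  (X : set 'rV[R]_n)
  (X0 : X !=set0) (Xclosed : closed X) (Xconvex : convex_set X)
  (Xbounded : bounded_set X)
  (psi : 'rV[R]_n -> R) (gpsi : 'rV[R]_n -> 'rV[R]_n) (alpha : R)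
  (psiC1 : C1_on X psi gpsi)
  (alpha0 : 0 < alpha) (psi_sc : strongly_convex_on nrm X psi gpsi alpha)
  (F : 'rV[R]_n -> 'rV[R]_n) (nu L M : R)
  (Fmono : monotone_on X F)
  (nu0 : 0 <= nu) (L0 : 0 < L) (M0 : 0 <= M)
  (Fgrowth : growth_condition nrm X F nu L M)
  (d d' : measure_display) (S : measurableType d) (Om : measurableType d')
  (P : probability S R)
  (Fhat : 'rV[R]_n -> Om -> 'rV[R]_n) (Fhat_meas : oracle_measurable X Fhat)
  (xi : {RV P >-> Om}) (Fmean : oracle_mean P X F Fhat xi)
  (D : R) (D0 : 0 < D)
  (Dbound : forall x z, X x -> X z -> bregman psi gpsi z x <= D)
  (c a : R) (c0 : 0 < c) (a0 : 0 < a) (a1 : a < 1)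
  (xis : nat -> {RV P >-> Om}) (x y : nat -> S -> 'rV[R]_n)
  (x0_meas : measurable_fun setT (x 0%N : S -> borel_rV R n))
  (x0_moment : ('E_P[fun w => (nrm (x 0%N w) ^+ 2)%R] < +oo)%E)
  (algo : popov_mirror_prox X psi gpsi Fhat (step_size c a) xis x y)
  (sigma : R)
  (unbiased : forall (t : nat) z, X z ->
     unbiased_at P (history (x 0%N) xis t) F Fhat (xis t) (fun=> z))
  (unbiased_y : forall t : nat,
     unbiased_at P (history (x 0%N) xis t) F Fhat (xis t) (y t))
  (variance : forall (t : nat) z, X z ->
     bounded_variance_at P nrm (history (x 0%N) xis t) F Fhat (xis t)
       (fun=> z) sigma)
  (variance_y : forall t : nat,
     bounded_variance_at P nrm (history (x 0%N) xis t) F Fhat (xis t)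
       (y t) sigma) :
  forall T : nat,
  let EG := (\int[P]_w dual_gap X F (weighted_average (step_size c a) y T w))%E
  in
  let DH := Dhat nu L M alpha D sigma in
  let N : R := T.+1%:R in
  [/\ 0 < a < 2^-1 ->
        (EG <= (2 * D / (c * N `^ (1 - a))
                + DH * c / ((1 - 2 * a) * N `^ a))%:E)%E,
      a = 2^-1 ->
        (EG <= (2 * D / (c * N `^ (1 - a))
                + DH * c * (1 + ln N) / N `^ (1 - a))%:E)%E &
      2^-1 < a < 1 ->
        (EG <= (2 * D / (c * N `^ (1 - a))
                + 2 * a * DH * c / ((2 * a - 1) * N `^ (1 - a)))%:E)%E].
Proof.
move=> T EG DH N.
(* Strong convexity and the bound [D] on divergences give [nrm (u - z) ^+ 2 <= 2 * D / alpha] on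
   [X]; the growth condition then yields this constant. *)
pose A := L * (2 * D / alpha) `^ (nu / 2) + M.
have Fosc u z : X u -> X z -> dual_norm nrm (F u - F z) <= A.
  move=> Xu Xz; have := Fgrowth u z Xu Xz; move/le_trans; apply.
  rewrite lerD2r ler_pM2l//; apply: powR_le_half => //.
    exact: (is_norm_ge0 nrm_norm).
  have := le_trans (bregman_ge psi_sc Xz Xu) (Dbound z u Xz Xu).
  by rewrite ler_pdivlMr//; lra.
have g0 t : 0 < step_size c a t by exact: step_size_gt0.
have C0 : 0 <= DH.
  apply: le_trans (Dhat_ge sigma nu0 L0 M0 alpha0 D0).
  by rewrite divr_ge0 ?mulr_ge0 ?(ltW alpha0)// addr_ge0// mulr_ge0 ?sqr_ge0//.
have EGle : (EG <= ((2 * D + DH * \sum_(0 <= t < T.+1) step_size c a t ^+ 2)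
    / \sum_(0 <= t < T.+1) step_size c a t)%:E)%E.
  apply: le_trans (expected_gap_le nrm_norm X0 Xclosed Xconvex Xbounded psiC1
    alpha0 psi_sc Fmono Fhat_meas Dbound Fosc g0 x0_meas algo unbiased_y
    variance_y T) _.
  rewrite lee_fin ler_wpM2r ?invr_ge0//.
    by apply: sumr_ge0 => t _; exact: ltW.
  rewrite lerD2l ler_wpM2r//; first by apply: sumr_ge0 => t _; exact: sqr_ge0.
  exact: Dhat_ge.
split.
- by move=> /andP[_ ah]; apply: le_trans EGle _; rewrite lee_fin rate_lt_half// ltW.
- by move=> ah; apply: le_trans EGle _; rewrite lee_fin rate_eq_half// ltW.
- by move=> /andP[ah _]; apply: le_trans EGle _; rewrite lee_fin rate_gt_half// ltW.
Qed.
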